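(* There exist universal constants $c,C>0$ such that the following is true. Let $\gamma:[1,\infty)\to[1,\infty)$ be any function such that $\frac{\gamma(n)}{n^{1/3}}$ and $\frac{n}{\gamma(n)}$ are non-decreasing. Then there is a group $\Delta$ (a diagonal product of lamplighter groups as described in the context) such that, for the switch-or-walk measure $\mathfrak q$ on $\Delta$, $$\forall t\ge1,\qquad c\,\gamma(t)\le-\log\left(\mathfrak q^{(2t)}(e_\Delta)\right)\le C\gamma(t).$$
   Context: Diagonal products: let $A=\{a_1,\dots,a_{|A|}\}$ and $B=\{b_1,\dots,b_{|B|}\}$ be finite groups, let $(\Gamma_s)_{s\ge0}$ be a (possibly finite) sequence of groups, each generated by the union of two finite subgroups $A(s)=\{a_i(s)\}\simeq A$ and $B(s)=\{b_j(s)\}\simeq B$, and let $(k_s)_{s\ge0}$ be a strictly increasing sequence of even integers with $k_0=0$ and $k_{s+1}>2k_s$ (a last value $k_s=\infty$ is allowed, meaning that the corresponding factor is trivial). It is assumed that $\Gamma_0=A(0)\times B(0)$ and that the quotient of $\Gamma_s$ by the normal closure of the commutators $[a_i(s),b_j(s)]$ is isomorphic to $A\times B$. In the wreath product $\Delta_s=\Gamma_s\wr\mathbb Z$, whose elements are pairs (finitely supported function $\mathbb Z\to\Gamma_s$, integer), let $\tau(s)$ be the translation by $+1$ of $\mathbb Z$, let $\alpha_i(s)$ be the element with lamp $a_i(s)$ at position $0$ and trivial elsewhere, and $\beta_j(s)$ the element with lamp $b_j(s)$ at position $k_s$ and trivial elsewhere (both with integer coordinate $0$). The diagonal product $\Delta$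 is the quotient of the free product $\mathbb Z\ast A\ast B$ by the intersection over $s$ of the kernels of the maps to $\Delta_s$ sending the generator of $\mathbb Z$ to $\tau(s)$, $a_i$ to $\alpha_i(s)$, $b_j$ to $\beta_j(s)$; denote by $\tau,\alpha_i,\beta_j$ the images of the generators in $\Delta$. The switch-or-walk measure is $\mathfrak q=\frac12(\mu+\nu)$, where $\mu(\tau^{\pm1})=\frac12$ and $\nu$ is uniform on $\{\alpha_i,\beta_j:1\le i\le|A|,1\le j\le|B|\}$. $\mathfrak q^{(2t)}$ denotes the $2t$-fold convolution power of $\mathfrak q$, and $e_\Delta$ the neutral element of $\Delta$.
   Formalization: The normalization γ(1)=1 is added: with universal c, C chosen before γ, the claim fails at t=1 for γ(n)=Mn with M large, as q^{(2)}(e) ≥ 1/16 always; for general γ apply the theorem to γ/γ(1), so that constants depend only on γ(1). *)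

(* Defs.v *)
From HB Require Import structures.
From mathcomp Require Import all_boot all_order all_algebra fingroup.
From mathcomp Require Import finmap.
From mathcomp Require Import all_classical all_reals all_analysis.
From mathcomp Require Import generic_quotient.

Set Implicit Arguments.
Unset Strict Implicit.
Unset Printing Implicit Defensive.

Local Open Scope classical_set_scope.
Local Open Scope group_scope.

Definition is_subgroup (G : groupType) (H : set G) : Prop :=
  [/\ H 1, (forall x y, H x -> H y -> H (x * y)) & (forall x, H x -> H x^-1)].

Definition is_normal_subgroup (G : groupType) (H : set G) : Prop :=
  is_subgroup H /\ (forall x g, H x -> H (x ^ g)).

Definition generated (G : groupType) (S : set G) : set G :=
  smallest (@is_subgroup G) S.

Record normal_subgroup (G : groupType) := NormalSubgroup {
  nsub_set : set G;
  nsubP : is_normal_subgroup nsub_set }.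

Section NormalSubgroups.
Variable G : groupType.

Lemma normal_closure_subproof (S : set G) :
  is_normal_subgroup (smallest (@is_normal_subgroup G) S).
Proof.
split; first split.
- by move=> H [[[H1 _ _] _] _].
- by move=> x y hx hy H HH; case: (HH) => [[[_ HM _] _] _]; apply: HM; [exact: hx|exact: hy].
- by move=> x hx H HH; case: (HH) => [[[_ _ HV] _] _]; apply: HV; exact: hx.
- by move=> x g hx H HH; case: (HH) => [[_ HJ] _]; apply: HJ; exact: hx.
Qed.

Definition normal_closure (S : set G) : normal_subgroup G :=
  NormalSubgroup (normal_closure_subproof S).

Lemma kernels_subproof (I : Type) (P : I -> Prop) (H : I -> groupType)
    (f : forall i, {multiplicative G -> H i}) :
  is_normal_subgroup [set x | forall i, P i -> f i x = 1].
Proof.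
have f1 i : f i 1 = 1 by apply: (@mulgI _ (f i 1)); rewrite -gmulfM !mulg1.
split; first split.
- by move=> i _; exact: f1.
- by move=> x y hx hy i Pi; rewrite gmulfM hx // hy // mulg1.
- move=> x hx i Pi; apply: (@mulgI _ (f i x)).
  by rewrite -gmulfM mulgV f1 hx // mulg1.
- move=> x g hx i Pi; rewrite /conjg !gmulfM hx // mul1g.
  by rewrite -gmulfM mulVg f1.
Qed.

Definition kernels (I : Type) (P : I -> Prop) (H : I -> groupType)
    (f : forall i, {multiplicative G -> H i}) : normal_subgroup G :=
  NormalSubgroup (kernels_subproof P f).

End NormalSubgroups.

Section Quotient.
Variables (G : groupType) (N : normal_subgroup G).

Definition coset_rel (x y : G) : bool := `[< nsub_set N (x^-1 * y) >].

Lemma coset_rel_refl : reflexive coset_rel.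
Proof. by move=> x; apply/asboolP; rewrite mulVg; case: (nsubP N) => -[]. Qed.

Lemma coset_rel_sym : symmetric coset_rel.
Proof.
suff h x y : coset_rel x y -> coset_rel y x by move=> x y; apply/idP/idP; exact: h.
move=> /asboolP xy; apply/asboolP; rewrite -[y^-1 * x]invgK invgM invgK.
by case: (nsubP N) => -[_ _ NV] _; exact: NV.
Qed.

Lemma coset_rel_trans : transitive coset_rel.
Proof.
move=> y x z /asboolP xy /asboolP yz; apply/asboolP.
rewrite -[z](mulKg y^-1) invgK mulgA -[X in nsub_set N X]mulgA.
case: (nsubP N) => -[_ NM _] _.
by have := NM _ _ xy yz; rewrite !mulgA.
Qed.

Definition coset_equiv : equiv_rel G :=
  EquivRel coset_rel coset_rel_refl coset_rel_sym coset_rel_trans.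

Definition quotient_group : Type := {eq_quot coset_equiv}%qT.
HB.instance Definition _ := Choice.on quotient_group.
HB.instance Definition _ := Quotient.on quotient_group.

Definition qproj (x : G) : quotient_group := \pi_quotient_group%qT x.

Lemma qprojP x y : qproj x = qproj y <-> nsub_set N (x^-1 * y).
Proof.
split=> [/eqmodP/asboolP //|h]; by apply/eqmodP/asboolP.
Qed.

Definition qmul (u v : quotient_group) := qproj (repr u * repr v).
Definition qinv (u : quotient_group) := qproj (repr u)^-1.

Lemma qreprK u : qproj (repr u) = u. Proof. exact: reprK. Qed.

Lemma qprojM x y : qproj (x * y) = qmul (qproj x) (qproj y).
Proof.
rewrite /qmul; have /qprojP := esym (qreprK (qproj x)).
have /qprojP := esym (qreprK (qproj y)).
move: (repr (qproj x)) (repr (qproj y)) => x' y' hy hx; apply/qprojP.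
have [[_ NM _] NJ] := nsubP N.
have := NM _ _ (NJ _ y hx) hy; rewrite /conjg invgM !mulgA.
by rewrite mulgK.
Qed.

Lemma qprojV x : qproj x^-1 = qinv (qproj x).
Proof.
rewrite /qinv; have /qprojP := esym (qreprK (qproj x)).
move: (repr (qproj x)) => x' hx; apply/qprojP; rewrite invgK.
have [[_ _ NV] NJ] := nsubP N.
have := NJ _ x^-1 (NV _ hx); rewrite /conjg !invgM !invgK.
by rewrite -!mulgA mulgV mulg1.
Qed.

Let qV u : (qproj (repr u) = u) * (u = qproj (repr u)).
Proof. by rewrite qreprK. Qed.

Lemma qmulA : associative qmul.
Proof.
by move=> u v w; rewrite (qV u).2 (qV v).2 (qV w).2 -!qprojM mulgA.
Qed.
Lemma qmul1 : left_id (qproj 1) qmul.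
Proof. by move=> u; rewrite (qV u).2 -qprojM mul1g. Qed.
Lemma q1mul : right_id (qproj 1) qmul.
Proof. by move=> u; rewrite (qV u).2 -qprojM mulg1. Qed.
Lemma qmulV : left_inverse (qproj 1) qinv qmul.
Proof. by move=> u; rewrite (qV u).2 -qprojV -qprojM mulVg. Qed.
Lemma qVmul : right_inverse (qproj 1) qinv qmul.
Proof. by move=> u; rewrite (qV u).2 -qprojV -qprojM mulgV. Qed.

HB.instance Definition _ :=
  isGroup.Build quotient_group qmulA qmul1 q1mul qmulV qVmul.

HB.instance Definition _ :=
  isMultiplicative.Build G quotient_group qproj qprojM.

End Quotient.

Definition isomorphic (G H : groupType) : Prop :=
  exists f : {multiplicative G -> H}, bijective f.

Section FreeProduct.
Variables A B : groupType.

Definition letter : Type := (int + (A + B))%type.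
HB.instance Definition _ := Choice.on letter.

Definition letZ (n : int) : letter := inl n.
Definition letA (a : A) : letter := inr (inl a).
Definition letB (b : B) : letter := inr (inr b).

(* The congruence on words merging adjacent letters of the same factor and
   erasing the neutral letters. *)
Inductive word_eq : seq letter -> seq letter -> Prop :=
| word_refl w : word_eq w w
| word_sym w1 w2 : word_eq w1 w2 -> word_eq w2 w1
| word_trans w1 w2 w3 : word_eq w1 w2 -> word_eq w2 w3 -> word_eq w1 w3
| word_cat u1 u2 v1 v2 :
    word_eq u1 u2 -> word_eq v1 v2 -> word_eq (u1 ++ v1) (u2 ++ v2)
| word_Z0 : word_eq [:: letZ 0] [::]
| word_A1 : word_eq [:: letA 1] [::]
| word_B1 : word_eq [:: letB 1] [::]
| word_ZD m n : word_eq [:: letZ m; letZ n] [:: letZ (m + n)%R]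
| word_AM a a' : word_eq [:: letA a; letA a'] [:: letA (a * a')]
| word_BM b b' : word_eq [:: letB b; letB b'] [:: letB (b * b')].

Definition word_rel (u v : seq letter) : bool := `[< word_eq u v >].

Lemma word_rel_refl : reflexive word_rel.
Proof. by move=> u; apply/asboolP; exact: word_refl. Qed.
Lemma word_rel_sym : symmetric word_rel.
Proof. by move=> u v; apply/asboolP/asboolP; exact: word_sym. Qed.
Lemma word_rel_trans : transitive word_rel.
Proof.
by move=> v u w /asboolP uv /asboolP vw; apply/asboolP; exact: word_trans uv vw.
Qed.

Definition word_equiv : equiv_rel (seq letter) :=
  EquivRel word_rel word_rel_refl word_rel_sym word_rel_trans.

Definition free_product : Type := {eq_quot word_equiv}%qT.
HB.instance Definition _ := Choice.on free_product.
HB.instance Definition _ := Quotient.on free_product.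

Definition word_class (w : seq letter) : free_product := \pi_free_product%qT w.

Definition inv_letter (l : letter) : letter :=
  match l with
  | inl n => letZ (- n)%R
  | inr (inl a) => letA a^-1
  | inr (inr b) => letB b^-1
  end.

Definition inv_word (w : seq letter) : seq letter := rev (map inv_letter w).

Lemma word_classP u v : word_class u = word_class v <-> word_eq u v.
Proof. by split=> [/eqmodP/asboolP //|h]; apply/eqmodP/asboolP. Qed.

Lemma word_mulV w : word_eq (w ++ inv_word w) [::].
Proof.
have letV l : word_eq [:: l; inv_letter l] [::].
  case: l => [n|[a|b]] /=.
  - by apply: word_trans (word_ZD _ _) _; rewrite GRing.subrr; exact: word_Z0.
  - by apply: word_trans (word_AM _ _) _; rewrite mulgV; exact: word_A1.
  - by apply: word_trans (word_BM _ _) _; rewrite mulgV; exact: word_B1.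
elim: w => [|l w IHw]; first exact: word_refl.
rewrite /inv_word /= rev_cons -cats1 -/(inv_word w) catA.
apply: word_trans (letV l); rewrite -cat1s.
apply: (@word_cat [:: l] [:: l] _ [:: inv_letter l] (word_refl _)).
exact: (@word_cat _ [::] _ _ IHw (word_refl _)).
Qed.

Lemma inv_wordK : involutive inv_word.
Proof.
move=> w; rewrite /inv_word map_rev revK -map_comp map_id_in // => -[n|[a|b]] _ /=.
- by rewrite GRing.opprK.
- by rewrite invgK.
- by rewrite invgK.
Qed.

Lemma word_Vmul w : word_eq (inv_word w ++ w) [::].
Proof. by rewrite -[X in _ ++ X]inv_wordK; exact: word_mulV. Qed.

Lemma word_inv u v : word_eq u v -> word_eq (inv_word u) (inv_word v).
Proof.
move=> uv; have h : word_eq (inv_word u ++ (v ++ inv_word v)) (inv_word u).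
  rewrite -[X in word_eq _ X]cats0; apply: word_cat (word_refl _) _.
  exact: word_mulV.
apply: word_trans (word_sym h) _; rewrite catA -[X in word_eq _ X]cat0s.
apply: word_cat (word_refl _); apply: word_trans (word_Vmul u).
by apply: word_cat (word_refl _) (word_sym uv).
Qed.

Definition fmul (x y : free_product) := word_class (repr x ++ repr y).
Definition finv (x : free_product) := word_class (inv_word (repr x)).

Lemma freprK x : word_class (repr x) = x. Proof. exact: reprK. Qed.

Lemma repr_word w : word_eq (repr (word_class w)) w.
Proof. by apply/word_classP; rewrite freprK. Qed.

Lemma word_classM u v : word_class (u ++ v) = fmul (word_class u) (word_class v).
Proof. by apply/word_classP; apply: word_cat; apply/word_sym/repr_word. Qed.

Lemma word_classV u : word_class (inv_word u) = finv (word_class u).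
Proof. by apply/word_classP/word_inv/word_sym/repr_word. Qed.

Let fV x : (word_class (repr x) = x) * (x = word_class (repr x)).
Proof. by rewrite freprK. Qed.

Lemma fmulA : associative fmul.
Proof.
by move=> x y z; rewrite (fV x).2 (fV y).2 (fV z).2 -!word_classM catA.
Qed.
Lemma fmul1 : left_id (word_class [::]) fmul.
Proof. by move=> x; rewrite (fV x).2 -word_classM. Qed.
Lemma f1mul : right_id (word_class [::]) fmul.
Proof. by move=> x; rewrite (fV x).2 -word_classM cats0. Qed.
Lemma fmulV : left_inverse (word_class [::]) finv fmul.
Proof.
move=> x; rewrite (fV x).2 -word_classV -word_classM.
by apply/word_classP/word_Vmul.
Qed.
Lemma fVmul : right_inverse (word_class [::]) finv fmul.
Proof.
move=> x; rewrite (fV x).2 -word_classV -word_classM.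
by apply/word_classP/word_mulV.
Qed.

HB.instance Definition _ := isGroup.Build free_product fmulA fmul1 f1mul fmulV fVmul.

Definition freeZ : free_product := word_class [:: letZ 1].
Definition freeA (a : A) : free_product := word_class [:: letA a].
Definition freeB (b : B) : free_product := word_class [:: letB b].

Section Lift.
Variables (H : groupType) (t : H).
Variables (f : {multiplicative A -> H}) (g : {multiplicative B -> H}).

Definition zpow (n : int) : H :=
  match n with Posz m => t ^+ m | Negz m => t ^- m.+1 end.

Definition eval_letter (l : letter) : H :=
  match l with
  | inl n => zpow n
  | inr (inl a) => f a
  | inr (inr b) => g b
  end.

Definition eval_word (w : seq letter) : H := \prod_(l <- w) eval_letter l.

Definition free_lift (x : free_product) : H := eval_word (repr x).

Lemma zpowB m n : zpow (m%:Z - n%:Z)%R = t ^+ m * t ^- n.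
Proof.
have [le_nm|lt_mn] := leqP n m.
  by rewrite subzn //= -{2}(subnK le_nm) expgnDr mulgK.
have -> : (m%:Z - n%:Z)%R = Negz (n - m).-1.
  rewrite NegzE prednK ?subn_gt0 // -subzn ?(ltnW lt_mn) //.
  by rewrite GRing.opprB.
rewrite /= prednK ?subn_gt0 // -{2}(subnK (ltnW lt_mn)) expgnDr.
by rewrite invgM mulgA mulgV mul1g.
Qed.

Lemma zpowD m n : zpow (m + n)%R = zpow m * zpow n.
Proof.
have dec (z : int) : exists p q : nat, z = (p%:Z - q%:Z)%R.
  case: z => p; first by exists p, 0; rewrite GRing.subr0.
  by exists 0, p.+1; rewrite GRing.sub0r NegzE.
have comm (p q : nat) : t ^- p * t ^+ q = t ^+ q * t ^- p.
  apply: (@mulgI _ (t ^+ p)); rewrite mulgA mulgV mul1g mulgA -expgnDr addnC.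
  by rewrite expgnDr mulgK.
have [[a [b ->]] [c [d ->]]] := (dec m, dec n).
have -> : (a%:Z - b%:Z + (c%:Z - d%:Z) = (a + c)%N%:Z - (d + b)%N%:Z)%R.
  by rewrite !PoszD GRing.addrACA GRing.opprD [(- d%:Z + _)%R]GRing.addrC.
rewrite !zpowB !expgnDr invgM -!mulgA; congr (_ * _).
by rewrite !mulgA comm.
Qed.

Lemma eval_word_eq u v : word_eq u v -> eval_word u = eval_word v.
Proof.
have h1 (X : groupType) (h : {multiplicative X -> H}) : h 1 = 1.
  by apply: (@mulgI _ (h 1)); rewrite -gmulfM !mulg1.
rewrite /eval_word; elim=> {u v} //=.
- by move=> u v w _ -> _ ->.
- by move=> u1 u2 v1 v2 _ hu _ hv; rewrite !big_cat /= hu hv.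
- by rewrite big_seq1 big_nil.
- by rewrite big_seq1 big_nil /= h1.
- by rewrite big_seq1 big_nil /= h1.
- by move=> m n; rewrite !big_cons big_nil /= mulg1 zpowD mulg1.
- by move=> a a'; rewrite !big_cons big_nil /= !mulg1 gmulfM.
- by move=> b b'; rewrite !big_cons big_nil /= !mulg1 gmulfM.
Qed.

Lemma free_liftM x y : free_lift (x * y) = free_lift x * free_lift y.
Proof.
rewrite /free_lift (eval_word_eq (repr_word _)).
by rewrite /eval_word big_cat.
Qed.

HB.instance Definition _ :=
  isMultiplicative.Build free_product H free_lift free_liftM.

Lemma free_lift_word w : free_lift (word_class w) = eval_word w.
Proof. exact/eval_word_eq/repr_word. Qed.

End Lift.
End FreeProduct.

Section Wreath.
Variable G : groupType.

Definition wreath : Type := ({fsfun int -> G with 1} * int)%type.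
HB.instance Definition _ := Choice.on wreath.

Local Open Scope fset_scope.

(* (f, i) (g, j) = (f . (T_i g), i + j), where (T_i g) x = g (x - i) *)
Definition wmul (u v : wreath) : wreath :=
  ([fsfun x in finsupp u.1 `|` [fset (y + u.2)%R | y in finsupp v.1] =>
      u.1 x * v.1 (x - u.2)%R | 1],
   (u.2 + v.2)%R).

Definition wone : wreath := ([fsfun for fun=> 1], 0%R).

Definition winv (u : wreath) : wreath :=
  ([fsfun x in [fset (y - u.2)%R | y in finsupp u.1] => (u.1 (x + u.2)%R)^-1 | 1],
   (- u.2)%R).

Lemma wmulE u v x : (wmul u v).1 x = u.1 x * v.1 (x - u.2)%R.
Proof.
rewrite fsfun_fun; case: ifPn => //; rewrite inE negb_or => /andP[xu xv].
rewrite (fsfun_dflt xu) mul1g fsfun_dflt //; apply: contra xv => xv.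
by apply/imfsetP; exists (x - u.2)%R; rewrite ?GRing.subrK.
Qed.

Lemma winvE u x : (winv u).1 x = (u.1 (x + u.2)%R)^-1.
Proof.
rewrite fsfun_fun; case: ifPn => // xu.
rewrite fsfun_dflt ?invg1 //; apply: contra xu => xu.
by apply/imfsetP; exists (x + u.2)%R; rewrite ?GRing.addrK.
Qed.

Lemma woneE x : wone.1 x = 1. Proof. exact: fsfun0E. Qed.

Lemma wreathP (u v : wreath) : u.1 =1 v.1 -> u.2 = v.2 -> u = v.
Proof. by case: u v => [f i] [g j] /= /fsfunP -> ->. Qed.

Lemma wmulA : associative wmul.
Proof.
move=> u v w; apply: wreathP => [x|]; last by rewrite /= GRing.addrA.
by rewrite !wmulE /= mulgA GRing.opprD GRing.addrA.
Qed.
Lemma wmul1 : left_id wone wmul.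
Proof.
move=> u; apply: wreathP => [x|]; last by rewrite /= GRing.add0r.
by rewrite wmulE woneE mul1g GRing.subr0.
Qed.
Lemma w1mul : right_id wone wmul.
Proof.
move=> u; apply: wreathP => [x|]; last by rewrite /= GRing.addr0.
by rewrite wmulE woneE mulg1.
Qed.
Lemma wmulV : left_inverse wone winv wmul.
Proof.
move=> u; apply: wreathP => [x|]; last by rewrite /= GRing.addNr.
by rewrite wmulE winvE woneE /= GRing.opprK mulVg.
Qed.
Lemma wVmul : right_inverse wone winv wmul.
Proof.
move=> u; apply: wreathP => [x|]; last by rewrite /= GRing.subrr.
by rewrite wmulE winvE woneE GRing.subrK mulgV.
Qed.

HB.instance Definition _ := isGroup.Build wreath wmulA wmul1 w1mul wmulV wVmul.

Definition wtrans : wreath := ([fsfun for fun=> 1], 1%R).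

Definition wlamp (p : int) (x : G) : wreath :=
  ([fsfun y in [fset p] => x | 1], 0%R).

Lemma wlampE p x y : (wlamp p x).1 y = if y == p then x else 1.
Proof. by rewrite fsfun_fun inE. Qed.

Section LampMorphism.
Variables (X : groupType) (h : {multiplicative X -> G}) (p : int).

Definition lamp_at (x : X) : wreath := wlamp p (h x).

Lemma lamp_atM x y : lamp_at (x * y) = lamp_at x * lamp_at y.
Proof.
apply: wreathP => [z|]; last by rewrite /= GRing.addr0.
by rewrite wmulE !wlampE GRing.subr0 gmulfM; case: ifP; rewrite ?mulg1.
Qed.

HB.instance Definition _ := isMultiplicative.Build X wreath lamp_at lamp_atM.
End LampMorphism.
End Wreath.

(* [shift s = None] encodes both k_s = oo and the absence of the index s in a
   finite sequence: in either case the factor of index s is trivial and nothing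
   is required of [lampG s]. *)
Record diagonal_data := DiagonalData {
  grpA : finGroupType;
  grpB : finGroupType;
  lampG : nat -> groupType;
  embA : forall s, {multiplicative grpA -> lampG s};
  embB : forall s, {multiplicative grpB -> lampG s};
  shift : nat -> option nat;
  embA_inj : forall s, isSome (shift s) -> injective (embA s);
  embB_inj : forall s, isSome (shift s) -> injective (embB s);
  lampG_gen : forall s, isSome (shift s) ->
    generated (range (embA s) `|` range (embB s)) = [set: lampG s];
  (* Gamma_0 = A(0) x B(0), as an internal direct product *)
  lampG0_comm : forall a b, commute (embA 0 a) (embB 0 b);
  lampG0_prod : bijective (fun x : grpA * grpB => embA 0 x.1 * embB 0 x.2);
  lampG_quot : forall s, isSome (shift s) ->
    isomorphic
      (quotient_group (normal_closure
        [set x | exists a b, x = [~ embA s a, embB s b]]))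
      (grpA * grpB)%type;
  shift0 : shift 0 = Some 0;
  shift_None : forall s, shift s = None -> shift s.+1 = None;
  shift_even : forall s k, shift s = Some k -> ~~ odd k;
  shift_incr : forall s k k', shift s = Some k -> shift s.+1 = Some k' ->
    k < k' /\ 2 * k < k' }.

Section DiagonalProduct.
Variable D : diagonal_data.

Local Notation free := (free_product (grpA D) (grpB D)).

(* The default value of k is irrelevant: only the s with k_s finite are used. *)
Definition to_wreath (s : nat) : {multiplicative free -> wreath (lampG D s)} :=
  let k := odflt 0 (shift D s) in
  free_lift (wtrans _) (lamp_at (embA D s) 0%:Z) (lamp_at (embB D s) k%:Z).

Definition diagonal_product : groupType :=
  quotient_group (kernels (fun s => isSome (shift D s)) to_wreath).

Definition diag_tau : diagonal_product := qproj _ (freeZ _ _).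
Definition diag_alpha (a : grpA D) : diagonal_product := qproj _ (freeA _ a).
Definition diag_beta (b : grpB D) : diagonal_product := qproj _ (freeB _ b).

End DiagonalProduct.

Section Convolution.
Variables (R : realType) (G : groupType).

(* \sum_(y \in _) is 0 when infinitely many terms are nonzero; here it is only
   applied to finitely supported p. *)
Definition convolution (p q : G -> R) (x : G) : R :=
  (\sum_(y \in [set: G]) p y * q (y^-1 * x)%g)%R.

Definition convolution_power (q : G -> R) (n : nat) : G -> R :=
  iter n (convolution q) (fun x => (x == 1%g)%:R%R).

End Convolution.

Section SwitchOrWalk.
Variables (R : realType) (D : diagonal_data).

Local Open Scope ring_scope.

Definition walk_measure (x : diagonal_product D) : R :=
  2^-1 * (x == diag_tau D)%:R + 2^-1 * (x == (diag_tau D)^-1%g)%:R.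

(* alpha 1 and beta 1 coincide, and the set {alpha_i, beta_j} counts the neutral
   element once. *)
Definition switch_set : seq (diagonal_product D) :=
  undup (codom (@diag_alpha D) ++ codom (@diag_beta D)).

Definition switch_measure (x : diagonal_product D) : R :=
  (x \in switch_set)%:R / (size switch_set)%:R.

Definition switch_or_walk (x : diagonal_product D) : R :=
  2^-1 * (walk_measure x + switch_measure x).

End SwitchOrWalk.

Arguments walk_measure R D x : clear implicits.
Arguments switch_measure R D x : clear implicits.
Arguments switch_or_walk R D x : clear implicits.

(* Main.v *)
(* Lower bound on the decay. Let [A = B] be cyclic of order 17 and let the lamp groups be
   images of [A * B] in the product of [A x B] and of the group generated by the shears
   [y += a X x] and [x += b X y] of the plane over [F_17[X]], modulo [X^D] (or modulo 0).
   Since [A * B] acts on the 17-regular tree, and words shorter than [D / 2] are not identified modulo [X^D], a lamp that has seen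
   [N] alternations between A- and B-switches returns to [1] with probability at most
   [2 ^- min (N, L)] where [L ~ D / 2]. Given the walk on [Z] the lamps are independent,
   so the return probability is at most [E (2 ^- S)] with [S] the sum over the lamps of
   [min (N, L)]. If [S < r L] then, within distance [2 r] of the walker, some switch
   increases [S]; a quadratic barrier in the distance to it turns this into a
   supermartingale, and [q^(2t) 1 <= 2 (1 - c / r^2) ^ (2t) + 2 ^- (r L)] for [r >= k].
   Upper bound on the decay: confine the walk to [[-r, r]] (cost [t / r^2]); the factors
   with [k_s > 2 r] are then determined by [Delta_0], so the element takes at most
   [exp (C r (1 + sum of the D_s with k_s <= 2 r))] values, and Cauchy-Schwarz applies.
   Finally, with [r(t)^2 = t / gamma t] and [l(t)^2 = (gamma t)^3 / t], which are both
   nondecreasing, [gamma t = t / r^2 = r l]. One takes [k_(s+1) = 2 4^s] and, for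
   [D_(s+1)], about twice the largest power of two below the values of [l] reached before
   [r] exceeds [4^(s+1)]: if this power is the same as for [D_s], then [D_(s+1) = 0],
   so that [Gamma_(s+1) = A x B] costs nothing; if those values are unbounded, the modulus
   is 0 instead of a power of [X]. *)
From HB Require Import structures.
Require Import Defs.
From mathcomp Require Import all_boot all_order all_algebra fingroup finmap.
From mathcomp Require Import all_classical all_reals all_analysis.
From mathcomp Require Import generic_quotient ring lra zify.

Set Implicit Arguments.
Unset Strict Implicit.
Unset Printing Implicit Defensive.

Import Order.TTheory GRing.Theory Num.Theory.

Local Open Scope ring_scope.

Local Notation F := 'F_17.
Local Notation vec := ({poly F} * {poly F})%type.

(** * Walks given by finitely many weighted letters *)

(** Cauchy-Schwarz, from the nonnegativity of the sum of the squares [(n * m k - s) ^+ 2]. *)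
Lemma sqr_sum_le_card (R : realType) (K : finType) (m : K -> R) :
  (\sum_k m k) ^+ 2 <= #|K|%:R * \sum_k m k ^+ 2.
Proof.
have [K0|K_gt0] := posnP #|K|.
  rewrite (eq_bigl pred0) => [|k]; last by have := fintype0 k K0.
  by rewrite big_pred0_eq expr0n /= mulr_ge0 ?sumr_ge0 // => k _; apply: sqr_ge0.
set s := \sum_k m k; set n : R := #|K|%:R.
have n_gt0 : 0 < n by rewrite ltr0n.
have : 0 <= \sum_k (n * m k - s) ^+ 2 by apply: sumr_ge0 => k _; apply: sqr_ge0.
have -> : \sum_k (n * m k - s) ^+ 2
    = \sum_k (n ^+ 2 * m k ^+ 2) + \sum_k (- (2 * n * s) * m k) + \sum_(k : K) s ^+ 2.
  by rewrite -!big_split /=; apply: eq_bigr => k _; ring.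
rewrite -!mulr_sumr sumr_const -/s -mulr_natl -/n => h.
rewrite -(ler_pM2l n_gt0) -subr_ge0; apply: le_trans h _.
by rewrite le_eqVlt; apply/orP; left; apply/eqP; ring.
Qed.

Section FiniteLetterWalk.
Variables (R : realType) (G : groupType) (L : finType) (wt : L -> R) (ev : L -> G).
Hypothesis wt_ge0 : forall l, 0 <= wt l.

(** Letters carry their own weights, so [ev] need not be injective: the neutral letters of A and of
    B have the same value. *)
Fixpoint walk_prob (m : nat) (x : G) : R :=
  if m is m'.+1 then \sum_l wt l * walk_prob m' ((ev l)^-1 * x)%g
  else (x == 1%g)%:R.

Lemma walk_prob_ge0 m x : 0 <= walk_prob m x.
Proof.
elim: m x => [|m IHm] x /=; first exact: ler0n.
by apply: sumr_ge0 => l _; rewrite mulr_ge0.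
Qed.

(** The support of [q] lies in the finite list [codom ev], which turns the sum over the group into a
    sum over letters. *)
Lemma convolution_letters (q p : G -> R) (x : G) :
  (forall y, q y = \sum_l wt l * (y == ev l)%:R) ->
  convolution q p x = \sum_l wt l * p ((ev l)^-1 * x)%g.
Proof.
move=> qE; rewrite /convolution (fsbigE (undup (codom ev))) ?undup_uniq //.
- rewrite (eq_bigl xpredT) => [|y]; last by rewrite in_setT.
  under eq_bigr => y _ do rewrite qE mulr_suml.
  rewrite exchange_big /=; apply: eq_bigr => l _.
  rewrite (bigD1_seq (ev l)) ?undup_uniq ?mem_undup ?codom_f //=.
  rewrite eqxx mulr1 big1 ?addr0 // => y /negPf ->.
  by rewrite mulr0 mul0r.
- move=> y _; rewrite mem_undup => yNcodom; rewrite qE big1 ?mul0r // => l _.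
  case: eqP => [yE|]; last by rewrite mulr0.
  by rewrite yE codom_f in yNcodom.
Qed.

Lemma convolution_power_letters (q : G -> R) m x :
  (forall y, q y = \sum_l wt l * (y == ev l)%:R) ->
  convolution_power q m x = walk_prob m x.
Proof.
move=> qE; elim: m x => [//|m IHm] x.
rewrite /convolution_power iterS (convolution_letters _ _ qE) /=.
by apply: eq_bigr => l _; rewrite -IHm.
Qed.

Lemma walk_probSr m x :
  walk_prob m.+1 x = \sum_l wt l * walk_prob m (x * (ev l)^-1)%g.
Proof.
elim: m x => [|m IHm] x.
  apply: eq_bigr => l _ /=; congr (_ * (nat_of_bool _)%:R).
  apply/eqP/eqP => h; first by rewrite -[x](mulKVg (ev l)) h mulg1 mulgV.
  by rewrite -[x](mulgKV (ev l)) h mul1g mulVg.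
rewrite [LHS]/=; under eq_bigr => l _ do rewrite -/(walk_prob m.+1 _) IHm mulr_sumr.
rewrite exchange_big /=; apply: eq_bigr => l' _.
by rewrite mulr_sumr; apply: eq_bigr => l _; rewrite mulrCA mulgA.
Qed.

Variable inv : L -> L.
Hypotheses (invK : involutive inv) (wt_inv : forall l, wt (inv l) = wt l).
Hypothesis ev_inv : forall l, ev (inv l) = (ev l)^-1%g.

(** Reading a word backwards with inverted letters preserves its weight. *)
Lemma walk_probV m x : walk_prob m x^-1%g = walk_prob m x.
Proof.
elim: m x => [|m IHm] x; first by rewrite /= invg_eq1.
rewrite [RHS]walk_probSr (reindex_inj (inv_inj invK)) /=.
by apply: eq_bigr => l _; rewrite wt_inv ev_inv invgK -[in RHS]IHm invgM.
Qed.

Variable ok : pred G.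

(** One weighted entry per surviving word, so that no sum over [G] is needed; the mass of a point is
    the sum of its entries. *)
Fixpoint killed_law (m : nat) : seq (R * G) :=
  if m is m'.+1 then
    [seq p <- [seq (p.1 * wt l, (p.2 * ev l)%g) | p <- killed_law m', l <- enum L] | ok p.2]
  else [:: (1, 1%g)].

Lemma killed_law_ge0 m p : p \in killed_law m -> 0 <= p.1.
Proof.
elim: m p => [|m IHm] p /=; first by rewrite inE => /eqP ->.
by rewrite mem_filter => /andP[_ /allpairsP[[p' l] /= [/IHm ? _ ->]]]; rewrite mulr_ge0.
Qed.

Lemma sum_killed_lawS m (h : G -> R) :
  \sum_(p <- killed_law m.+1) p.1 * h p.2 =
  \sum_(p <- killed_law m) \sum_(l | ok (p.2 * ev l)%g) p.1 * wt l * h (p.2 * ev l)%g.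
Proof.
rewrite /= big_filter big_mkcond /= big_allpairs_dep.
apply: eq_bigr => p _; rewrite big_enum /= [RHS]big_mkcond.
by apply: eq_bigr => l _ /=.
Qed.

(** Markov property at time [m]; forgetting the killed words only loses mass. *)
Lemma killed_law_sub m n x :
  \sum_(p <- killed_law m) p.1 * walk_prob n (p.2^-1 * x)%g <= walk_prob (m + n) x.
Proof.
elim: m n => [|m IHm] n; first by rewrite big_seq1 mul1r invg1 mul1g.
rewrite (sum_killed_lawS _ (fun g => walk_prob n (g^-1 * x)%g)) addSnnS; apply: le_trans (IHm n.+1).
rewrite !big_seq; apply: ler_sum => p pP /=; rewrite mulr_sumr.
rewrite big_mkcond /=; apply: ler_sum => l _; case: ifP => _.
  by rewrite invgM -!mulgA mulrA.
by rewrite !mulr_ge0 ?walk_prob_ge0 ?(killed_law_ge0 pP).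
Qed.

(** With [psi] at most 1 on the support, this bounds the survival probability from below. *)
Lemma killed_law_mass (psi : G -> R) (beta : R) m :
  0 <= beta ->
  (forall m u, u \in map snd (killed_law m) ->
    beta * psi u <= \sum_(l | ok (u * ev l)%g) wt l * psi (u * ev l)%g) ->
  beta ^+ m * psi 1%g <= \sum_(p <- killed_law m) p.1 * psi p.2.
Proof.
move=> beta_ge0 sub; elim: m => [|m IHm]; first by rewrite big_seq1 !mul1r.
rewrite exprS -mulrA sum_killed_lawS.
apply: le_trans (ler_wpM2l beta_ge0 IHm) _.
rewrite mulr_sumr !big_seq; apply: ler_sum => p pP; rewrite mulrCA.
under eq_bigr => l _ do rewrite -mulrA.
rewrite -mulr_sumr; apply: ler_wpM2l; first exact: killed_law_ge0 pP.
by apply: sub; apply: map_f pP.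
Qed.

(* Cauchy-Schwarz: [P(X_2m = 1) = \sum_x P(X_m = x)^2]. *)
Lemma return_ge_killed_mass m (K : finType) (key : G -> K) :
  (forall p p', p \in killed_law m -> p' \in killed_law m ->
    key p.2 = key p'.2 -> p.2 = p'.2) ->
  (\sum_(p <- killed_law m) p.1) ^+ 2 <= #|K|%:R * walk_prob (2 * m) 1%g.
Proof.
move=> key_inj.
have split_key (h : R * G -> R) :
    \sum_(p <- killed_law m) h p = \sum_(k : K) \sum_(p <- killed_law m | key p.2 == k) h p.
  rewrite (exchange_big_dep xpredT) //=; apply: eq_bigr => p _.
  by rewrite (big_pred1 (key p.2)) // => k; rewrite eq_sym.
rewrite split_key; apply: le_trans (sqr_sum_le_card _) _.
apply: ler_wpM2l; first exact: ler0n.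
rewrite mul2n -addnn; apply: le_trans (killed_law_sub m m 1%g).
rewrite split_key; apply: ler_sum => k _; rewrite expr2 mulr_suml.
rewrite big_seq_cond [leRHS]big_seq_cond; apply: ler_sum => p /andP[pP /eqP pk].
apply: ler_wpM2l; first exact: killed_law_ge0 pP.
(* By symmetry the way back from [p.2] is as likely as the way to it, hence at least the mass of the
   entries with the same key, which all end at [p.2]. *)
rewrite mulg1 walk_probV -[m in walk_prob m]addn0.
apply: le_trans (killed_law_sub m 0 p.2).
rewrite big_mkcond /= !big_seq; apply: ler_sum => p' p'P; case: ifP => [/eqP p'k|_].
  by rewrite (key_inj p' p) ?mulVg ?eqxx ?mulr1 // p'k.
by rewrite mulr_ge0 ?ler0n ?(killed_law_ge0 p'P).
Qed.

End FiniteLetterWalk.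

(** * Congruence quotients of a free product of two cyclic groups *)

Definition shear (T : bool) (a : F) (v : vec) : vec :=
  if T then (v.1, v.2 + a *: ('X * v.1)) else (v.1 + a *: ('X * v.2), v.2).

Lemma shear0 T v : shear T 0 v = v.
Proof. by case: T v => -[x y]; rewrite /shear /= scale0r addr0. Qed.

Lemma shearD T a b v : shear T a (shear T b v) = shear T (b + a) v.
Proof. by case: T v => -[x y]; rewrite /shear /= scalerDl addrA. Qed.

(** The letters of Z act trivially, so that the quotients below are quotients of A * B. *)
Definition act_letter (l : letter F F) (v : vec) : vec :=
  match l with
  | inl _ => v
  | inr (inl a) => shear true a v
  | inr (inr b) => shear false b v
  end.

Definition act_word (w : seq (letter F F)) (v : vec) : vec :=
  foldl (fun v l => act_letter l v) v w.

Lemma act_word_cat w1 w2 v : act_word (w1 ++ w2) v = act_word w2 (act_word w1 v).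
Proof. exact: foldl_cat. Qed.

Lemma act_word_eq w1 w2 : word_eq w1 w2 -> act_word w1 =1 act_word w2.
Proof.
elim=> {w1 w2} //=.
- by move=> w1 w2 _ IH v; rewrite IH.
- by move=> w1 w2 w3 _ IH1 _ IH2 v; rewrite IH1.
- by move=> u1 u2 v1 v2 _ IHu _ IHv v; rewrite !act_word_cat IHu IHv.
(* The group law of [F] is addition: [1%g] converts to 0, and the products below to sums. *)
- by move=> v; exact: shear0.
- by move=> v; exact: shear0.
- by move=> a a' v; exact: shearD.
- by move=> b b' v; exact: shearD.
Qed.

Local Notation AB := (free_product F F).

Definition act (x : AB) : vec -> vec := act_word (repr x).

Lemma act_class w v : act (word_class w) v = act_word w v.
Proof. exact/act_word_eq/repr_word. Qed.

Lemma actM (x y : AB) v : act (x * y)%g v = act y (act x v).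
Proof. by rewrite /act (act_word_eq (repr_word _)) act_word_cat. Qed.

Lemma act1 v : act 1%g v = v.
Proof. exact: act_class [::] v. Qed.

Lemma actK x : cancel (act x) (act x^-1%g).
Proof. by move=> v; rewrite -actM mulgV act1. Qed.

Lemma actVK x : cancel (act x^-1%g) (act x).
Proof. by move=> v; rewrite -actM mulVg act1. Qed.

(** For [d = 0] this is equality, so infinite lamp groups need no separate construction. *)
Definition cong (d : {poly F}) (u v : vec) := (d %| u.1 - v.1) && (d %| u.2 - v.2).

Lemma cong_refl d v : cong d v v.
Proof. by rewrite /cong !subrr dvdp0. Qed.

Lemma cong_sym d u v : cong d u v = cong d v u.
Proof. by rewrite /cong -opprB dvdpNr -[u.2 - _]opprB dvdpNr. Qed.

Lemma cong_trans d v u w : cong d u v -> cong d v w -> cong d u w.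
Proof.
move=> /andP[uv1 uv2] /andP[vw1 vw2]; apply/andP.
by split; [rewrite -(subrKA v.1)|rewrite -(subrKA v.2)]; apply: dvdp_add.
Qed.

Lemma dvdp_shear (d x y z t : {poly F}) a :
  d %| x - z -> d %| y - t -> d %| (y + a *: ('X * x)) - (t + a *: ('X * z)).
Proof.
move=> xz yt; rewrite opprD addrACA -scalerBr -mulrBr dvdp_add //.
by rewrite -mul_polyC !dvdp_mull.
Qed.

Lemma shear_cong d T a u v : cong d u v -> cong d (shear T a u) (shear T a v).
Proof.
by case/andP=> uv1 uv2; case: T; apply/andP; split=> //=; exact: dvdp_shear.
Qed.

Lemma act_cong d x u v : cong d u v -> cong d (act x u) (act x v).
Proof.
rewrite /act; elim: (repr x) u v => //= l w IHw u v uv; apply: IHw.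
by case: l => [//|[a|b]]; [exact: (shear_cong true)|exact: (shear_cong false)].
Qed.

Lemma actE x v : act x v =
  (v.1 * (act x (1, 0)).1 + v.2 * (act x (0, 1)).1,
   v.1 * (act x (1, 0)).2 + v.2 * (act x (0, 1)).2).
Proof.
rewrite /act; elim/last_ind: (repr x) => [|w l IHw] /=.
  by rewrite !mulr1 !mulr0 addr0 add0r; case: v.
rewrite -cats1 !act_word_cat IHw.
case: l => [//|[a|b]] /=; rewrite /shear /=; congr (_, _);
  rewrite -!mul_polyC; ring.
Qed.

Section MulOne.
Variables (G H : groupType) (f : {multiplicative G -> H}).

Lemma multiplicative1 : f 1%g = 1%g.
Proof. by apply: (@mulgI _ (f 1%g)); rewrite -gmulfM !mulg1. Qed.

Lemma multiplicativeV x : f x^-1%g = (f x)^-1%g.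
Proof. by apply: (@mulgI _ (f x)); rewrite -gmulfM !mulgV multiplicative1. Qed.

End MulOne.

Lemma qproj_mulg (G : groupType) (N : normal_subgroup G) x y :
  qproj N (x * y)%g = (qproj N x * qproj N y)%g.
Proof. exact: qprojM. Qed.

Definition pair_left (a : F) : F * F := (a, 1%g).
Definition pair_right (b : F) : F * F := (1%g, b).

Lemma pair_leftM : {morph pair_left : a b / (a * b)%g}.
Proof. by move=> a b; congr (_, _); rewrite mulg1. Qed.
HB.instance Definition _ := isMultiplicative.Build F (F * F)%type pair_left pair_leftM.

Lemma pair_rightM : {morph pair_right : a b / (a * b)%g}.
Proof. by move=> a b; congr (_, _); rewrite mulg1. Qed.
HB.instance Definition _ := isMultiplicative.Build F (F * F)%type pair_right pair_rightM.

Definition ab_proj : {multiplicative AB -> (F * F)%type} :=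
  free_lift 1%g pair_left pair_right.

(** The condition on [ab_proj] keeps A x B a quotient, and A and B embedded, for every modulus. *)
Lemma cong_kernel_subproof d :
  is_normal_subgroup [set x : AB | ab_proj x = 1%g /\ forall v, cong d (act x v) v].
Proof.
split; first split.
- by split=> [|v]; [exact: multiplicative1|rewrite act1 cong_refl].
- move=> x y [px ax] [py ay]; split=> [|v]; first by rewrite gmulfM px py mulg1.
  by rewrite actM; apply: cong_trans (ay _) (ax _).
- move=> x [px ax]; split=> [|v]; first by rewrite multiplicativeV px invg1.
  by rewrite cong_sym -{1}[v](actVK x); exact: ax.
- move=> x g [px ax]; split=> [|v].
    by rewrite /conjg !gmulfM px mul1g -gmulfM mulVg multiplicative1.
  rewrite /conjg !actM -{2}[v](actVK g).
  by apply/act_cong; exact: ax.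
Qed.

Definition cong_kernel d : normal_subgroup AB := NormalSubgroup (cong_kernel_subproof d).

Definition cong_group (d : {poly F}) : groupType := quotient_group (cong_kernel d).

Lemma cong_kernelP d x : nsub_set (cong_kernel d) x <->
  ab_proj x = 1%g /\ forall v, cong d (act x v) v.
Proof. by []. Qed.

Lemma cong_group_eqP d (x y : AB) :
  qproj (cong_kernel d) x = qproj (cong_kernel d) y <->
  ab_proj x = ab_proj y /\ forall v, cong d (act x v) (act y v).
Proof.
split=> [/qprojP/cong_kernelP[p a]|[p a]].
  split=> [|v].
    by apply: (@mulgI _ (ab_proj x)^-1%g); rewrite mulVg -multiplicativeV -gmulfM p.
  by rewrite cong_sym -[act y v]/(act y v) -{1}[v](actK x) -actM; exact: a.
apply/qprojP/cong_kernelP; split=> [|v]; first by rewrite gmulfM multiplicativeV p mulVg.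
rewrite actM -{2}[v](actVK x) cong_sym; exact: a.
Qed.

Definition free_emb (T : bool) (a : F) : AB := if T then freeA F a else freeB F a.

Lemma free_embM T : {morph free_emb T : a b / (a * b)%g}.
Proof.
move=> a b; rewrite /free_emb; case: T.
  rewrite /freeA -[RHS]word_classM; apply/word_classP/word_sym/word_AM.
rewrite /freeB -[RHS]word_classM; apply/word_classP/word_sym/word_BM.
Qed.

Lemma act_free_emb T a v : act (free_emb T a) v = shear T a v.
Proof. by rewrite /free_emb; case: T; rewrite act_class. Qed.

Lemma ab_proj_free_emb T a :
  ab_proj (free_emb T a) = if T then (a, 1%g) else (1%g, a).
Proof.
by rewrite /free_emb; case: T; rewrite /ab_proj /= free_lift_word /eval_word big_seq1.
Qed.

Lemma free_product_ind (P : AB -> Prop) :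
  P 1%g -> (forall n x, P x -> P (word_class [:: letZ _ _ n] * x)%g) ->
  (forall T a x, P x -> P (free_emb T a * x)%g) -> forall x, P x.
Proof.
move=> P1 PZ PT x; rewrite -(freprK x); elim: (repr x) => [//|l w IHw].
rewrite -cat1s word_classM; case: l => [n|[a|b]]; first exact: PZ.
  exact: (PT true).
exact: (PT false).
Qed.

Section CongGroup.
Variable d : {poly F}.

Local Notation Gam := (cong_group d).

Definition cong_emb (T : bool) (a : F) : Gam := qproj (cong_kernel d) (free_emb T a).

Lemma cong_embM T : {morph cong_emb T : a b / (a * b)%g}.
Proof. by move=> a b; rewrite /cong_emb free_embM qproj_mulg. Qed.
HB.instance Definition _ T := isMultiplicative.Build F Gam (cong_emb T) (cong_embM T).

Definition cong_proj (u : Gam) : F * F := ab_proj (repr u).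

Lemma cong_proj_class x : cong_proj (qproj (cong_kernel d) x) = ab_proj x.
Proof. by have /cong_group_eqP[] := qreprK (qproj (cong_kernel d) x). Qed.

Lemma cong_projM : {morph cong_proj : u v / (u * v)%g}.
Proof.
move=> u v; rewrite -{1}(qreprK u) -{1}(qreprK v).
by rewrite -qproj_mulg cong_proj_class gmulfM.
Qed.
HB.instance Definition _ := isMultiplicative.Build Gam (F * F)%type cong_proj cong_projM.

Lemma cong_proj1 : cong_proj 1%g = 1%g.
Proof. exact: multiplicative1. Qed.

Lemma cong_projV u : cong_proj u^-1%g = (cong_proj u)^-1%g.
Proof. exact: multiplicativeV. Qed.

Lemma cong_proj_emb T a : cong_proj (cong_emb T a) = if T then (a, 1%g) else (1%g, a).
Proof. by rewrite cong_proj_class ab_proj_free_emb. Qed.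

Lemma cong_emb_inj T : injective (cong_emb T).
Proof.
by move=> a b /(congr1 cong_proj); rewrite !cong_proj_emb; case: T => -[].
Qed.

Lemma cong_group_ind (P : Gam -> Prop) :
  P 1%g -> (forall T a u, P u -> P (cong_emb T a * u)%g) -> forall u, P u.
Proof.
move=> P1 PM u; rewrite -(qreprK u); move: (repr u).
apply: free_product_ind => [|n x Px|T a x Px]; first exact: P1.
  rewrite qproj_mulg; suff -> : qproj (cong_kernel d) (word_class [:: letZ F F n]) = 1%g.
    by rewrite mul1g.
  apply/cong_group_eqP; split=> [|v]; last by rewrite act_class act1 cong_refl.
  rewrite multiplicative1 /ab_proj /= free_lift_word /eval_word big_seq1 /zpow /=.
  by case: n => n; rewrite /zpow expg1n ?invg1.
by rewrite qproj_mulg; exact: PM.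
Qed.

Lemma cong_group_gen :
  Defs.generated (range (cong_emb true) `|` range (cong_emb false))%classic = [set: Gam]%classic.
Proof.
apply/seteqP; split=> // u _ H [[H1 HM HV] sub].
elim/cong_group_ind: u => // T a u Hu; apply: HM => //; apply: sub.
by case: T; [left|right]; exists a.
Qed.

(** The projection to A x B kills the commutators. Conversely, modulo these the letters of A and B
    can be sorted, so a class is determined by its projection ([g_proj]). *)
Lemma cong_group_quot :
  isomorphic
    (quotient_group (normal_closure
      [set x | exists a b, x = [~ cong_emb true a, cong_emb false b]%g]%classic))
    (F * F)%type.
Proof.
set N := normal_closure _.
have N_proj x : nsub_set N x -> cong_proj x = 1%g.
  move=> /(_ [set x | cong_proj x = 1%g]%classic); apply; split; first split.
  - split=> [|y z /= hy /= hz|y /= hy]; first exact: cong_proj1.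
      by rewrite /= cong_projM hy hz mulg1.
    by rewrite /= cong_projV hy invg1.
  - by move=> y g /= hy; rewrite /= /conjg !cong_projM hy mul1g -cong_projM mulVg cong_proj1.
  - move=> _ [a [b ->]]; rewrite /= commgEl /conjg !cong_projM !cong_projV.
    by rewrite !cong_proj_emb; congr (_, _); rewrite /= ?(invg1, mul1g, mulg1) ?mulVg.
pose f (u : quotient_group N) : F * F := cong_proj (repr u).
have f_class x : f (qproj N x) = cong_proj x.
  have /qprojP/N_proj := qreprK (qproj N x).
  rewrite cong_projM cong_projV => e.
  by apply: (@mulgI _ (f (qproj N x))^-1%g); rewrite e mulVg.
have fM : {morph f : u v / (u * v)%g}.
  move=> u v; rewrite -{1}(qreprK u) -{1}(qreprK v).
  by rewrite -qproj_mulg f_class cong_projM.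
pose fm := HB.pack f (isMultiplicative.Build _ _ f fM) : {multiplicative quotient_group N -> _}.
exists fm.
pose g (ab : F * F) : quotient_group N :=
  qproj N (cong_emb true ab.1 * cong_emb false ab.2)%g.
have g_proj x : qproj N x = g (cong_proj x).
  elim/cong_group_ind: x => [|T a x IHx].
    by rewrite cong_proj1 /g !multiplicative1 mulg1.
  rewrite qproj_mulg IHx cong_projM cong_proj_emb /g.
  case: (cong_proj x) => b c; case: T => /=.
    by rewrite mul1g -(qproj_mulg N) mulgA -cong_embM.
  have swap : qproj N (cong_emb false a * cong_emb true b)%g
            = qproj N (cong_emb true b * cong_emb false a)%g.
    apply/qprojP => H [_ sub]; apply: sub; exists b, a.
    by rewrite commgEl /conjg invgM !mulgA.
  rewrite -(qproj_mulg N) mulgA [in LHS](qproj_mulg N) swap -(qproj_mulg N) -mulgA.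
  by rewrite mul1g -cong_embM.
exists g => [u|[a b]]; first by rewrite -(qreprK u) /= f_class -g_proj.
rewrite /= f_class cong_projM !cong_proj_emb; congr (_, _); first exact: mulg1.
exact: mul1g.
Qed.

End CongGroup.

(** Congruence modulo 1 is void, so only the projection to A x B is left. *)
Lemma cong_proj_inj (u v : cong_group 1) : cong_proj u = cong_proj v -> u = v.
Proof.
rewrite -(qreprK u) -(qreprK v) !cong_proj_class => uv; apply/cong_group_eqP.
by split=> // w; rewrite /cong !dvd1p.
Qed.

(** [None] gives modulus 0, the infinite lamp group; [Some 0] gives modulus 1, the group A x B. *)
Definition level_modulus (l : option nat) : {poly F} :=
  if l is Some D then 'X^D else 0.

(** * The diagonal data attached to a sequence of degrees *)

Section Data.
Variable lev : nat -> option nat.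

Definition data_modulus (s : nat) : {poly F} :=
  if s is s'.+1 then level_modulus (lev s') else 1.

Definition data_shift (s : nat) : nat := if s is s'.+1 then 2 * 4 ^ s' else 0.

Lemma data_comm0 a b : commute (cong_emb 1 true a) (cong_emb 1 false b).
Proof.
apply: cong_proj_inj; rewrite !cong_projM !cong_proj_emb.
by congr (_, _); rewrite /= ?mul1g ?mulg1.
Qed.

Lemma data_prod0 :
  bijective (fun x : F * F => (cong_emb 1 true x.1 * cong_emb 1 false x.2)%g).
Proof.
have proj a b : cong_proj (cong_emb 1 true a * cong_emb 1 false b)%g = (a, b).
  rewrite cong_projM !cong_proj_emb; congr (_, _); [exact: mulg1|exact: mul1g].
exists (@cong_proj 1) => [[a b]|u]; first exact: proj.
by apply: cong_proj_inj; rewrite proj; case: (cong_proj u).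
Qed.

Lemma data_shift_None s :
  Some (data_shift s) = None -> Some (data_shift s.+1) = None.
Proof. by []. Qed.

Lemma data_shift_even s k : Some (data_shift s) = Some k -> ~~ odd k.
Proof. by case=> <-; case: s => [|s] //=; rewrite oddM. Qed.

Lemma data_shift_incr s k k' :
  Some (data_shift s) = Some k -> Some (data_shift s.+1) = Some k' ->
  (k < k')%N /\ (2 * k < k')%N.
Proof.
case=> <- [<-]; case: s => [//|s] /=.
by have := expn_gt0 4 s; rewrite expnS; lia.
Qed.

Definition diag_data : diagonal_data :=
  @DiagonalData F F (fun s => cong_group (data_modulus s))
    (fun s => cong_emb (data_modulus s) true) (fun s => cong_emb (data_modulus s) false)
    (fun s => Some (data_shift s))
    (fun s _ => @cong_emb_inj _ true) (fun s _ => @cong_emb_inj _ false)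
    (fun s _ => cong_group_gen _) data_comm0 data_prod0 (fun s _ => cong_group_quot _)
    erefl data_shift_None data_shift_even data_shift_incr.

End Data.

(** * The law of a single lamp *)

Lemma card_F : #|{: F}| = 17%N. Proof. by rewrite card_Fp. Qed.

Definition fixed_coord (T : bool) (v : vec) : {poly F} := if T then v.1 else v.2.

Lemma fixed_shear T a v : fixed_coord T (shear T a v) = fixed_coord T v.
Proof. by case: T. Qed.

Lemma moved_shear T a v : fixed_coord (~~ T) (shear T a v) =
  fixed_coord (~~ T) v + a *: ('X * fixed_coord T v).
Proof. by case: T. Qed.

Lemma size_shear_term (a : F) (p : {poly F}) :
  a != 0 -> p != 0 -> size (a *: ('X * p)) = (size p).+1.
Proof. by move=> a0 p0; rewrite size_scale // mulrC size_mulX. Qed.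

(* Normal forms of the free product: [w] lists the nonzero letters, last one
   first; their types alternate and the last one has type [T]. *)
Fixpoint stack_vec (T : bool) (w : seq F) : vec :=
  if w is a :: w' then shear T a (stack_vec (~~ T) w') else (1, 1).

(** Ping-pong: a nonzero letter adds ['X] times the longer coordinate to the other one, so nothing
    cancels and the sizes record the depth in the tree. *)
Lemma size_stack_vec T (w : seq F) : all (predC1 0) w ->
  size (fixed_coord (~~ T) (stack_vec T w)) = (size w).+1 /\
  size (fixed_coord T (stack_vec T w)) = maxn 1 (size w).
Proof.
elim: w T => [|a w IHw] T /=; first by rewrite /fixed_coord; case: T; rewrite !size_poly1.
case/andP=> a0 /(IHw (~~ T)); rewrite negbK => -[IHm IHf].
rewrite moved_shear fixed_shear IHm; split; last by lia.
rewrite addrC size_polyDl size_shear_term ?IHm ?IHf //.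
- by rewrite -size_poly_eq0 IHm.
- by lia.
- by rewrite -size_poly_eq0 IHm.
Qed.

Lemma size_shear_le T a (v : vec) n :
  (size v.1 <= n)%N -> (size v.2 <= n)%N ->
  (size (shear T a v).1 <= n.+1)%N /\ (size (shear T a v).2 <= n.+1)%N.
Proof.
have size_step (p q : {poly F}) :
    (size p <= n -> size q <= n -> size (p + a *: ('X * q))%R <= n.+1)%N.
  move=> hp hq; rewrite (leq_trans (size_polyD _ _)) // geq_max leqW //=.
  rewrite (leq_trans (size_scale_leq _ _)) // mulrC.
  by have [->|q0] := eqVneq q 0; rewrite ?mul0r ?size_poly0 ?size_mulX.
by move=> h1 h2; case: T; split; by [exact: leqW|exact: size_step].
Qed.

Definition reachable (v : vec) : Prop :=
  exists T (w : seq F), all (predC1 0) w /\ v = stack_vec T w.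

Lemma reachable1 : reachable (1, 1).
Proof. by exists true, [::]. Qed.

(** A new letter is pushed on the normal form, merged with its last letter, or cancels it. *)
Lemma reachable_shear T a v : reachable v -> reachable (shear T a v).
Proof.
move=> [T' [w [w0 ->]]]; have [->|a0] := eqVneq a 0.
  by rewrite shear0; exists T', w.
case: w w0 => [|b w] w0; first by exists T, [:: a]; rewrite /= a0.
case: (eqVneq T' T) => [->|T'T]; last first.
  exists T, (a :: b :: w); rewrite /= a0 /=; split=> //.
  by move: T'T; case: (T) (T') => -[].
case/andP: w0 => b0 w0; rewrite [stack_vec _ _]/= shearD.
have [->|ba0] := eqVneq (b + a) 0; first by rewrite shear0; exists (~~ T), w.
by exists T, ((b + a) :: w); rewrite /= ba0.
Qed.

Lemma reachable_size T v : reachable v ->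
  [/\ (0 < size (fixed_coord T v))%N,
      (size (fixed_coord (~~ T) v) <= (size (fixed_coord T v)).+1)%N &
      (size (fixed_coord T v) <= (size (fixed_coord (~~ T) v)).+1)%N].
Proof.
move=> [T' [w [/(size_stack_vec T') [+ +] ->]]].
by case: (eqVneq T' T) => [->|]; [|case: T T' => -[]//= _]; move=> -> ->; split; lia.
Qed.

(** At most one neighbour is nearer to the root: two short results would differ by a nonzero
    multiple of ['X * q], which is longer than [q]. *)
Lemma card_short_moved T v : reachable v ->
  (#|[pred a | size (fixed_coord (~~ T) (shear T a v)) <= size (fixed_coord T v)]%N| <= 1)%N.
Proof.
move=> /(reachable_size T)[fT _ _]; apply/card_le1_eqP => b a; rewrite !inE !moved_shear.
set p := fixed_coord _ _; set q := fixed_coord _ _ => hb ha.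
apply/eqP; rewrite -subr_eq0; apply/negPn/negP => ab0.
have : (size ((a - b) *: ('X * q)) <= size q)%N.
  have -> : (a - b) *: ('X * q) = (p + a *: ('X * q)) - (p + b *: ('X * q)).
    by rewrite scalerBl; ring.
  by rewrite (leq_trans (size_polyD _ _)) // size_polyN geq_max ha hb.
by rewrite size_shear_term ?ltnn // -size_poly_gt0.
Qed.

Fixpoint alternations (s : seq bool) : nat :=
  if s is T :: s' then alternations s' + (ohead s' != Some T) else 0.

(** Counts the choices of one letter per block of equal types that bring [v] back to the root
    [(1, 1)]. *)
Fixpoint vec_count (s : seq bool) (v : vec) : nat :=
  if s is T :: s' then
    if ohead s' == Some T then vec_count s' v else \sum_(a : F) vec_count s' (shear T a v)
  else v == (1, 1).

(* A step to a random neighbour in the 17-regular tree maps [4 ^- depth] to at most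
   [8 / 17] times itself; the size of the coordinate that is left fixed by the last
   letter is the depth of a vertex, up to one. *)
Lemma vec_count_weight T s v : reachable v ->
  (vec_count (T :: s) v * 4 ^ size (fixed_coord T v) <= 4 * 8 ^ alternations (T :: s))%N.
Proof.
elim: s T v => [|T' s IHs] T v rv.
  rewrite /=; have [fv|fv] := eqVneq (fixed_coord T v) 1; last first.
    rewrite big1 // => a _; apply/eqP; rewrite eqb0; apply: contra fv => /eqP e.
    by rewrite -(fixed_shear T a) e; case: (T).
  rewrite fv size_poly1 !expn1 mulnC leq_mul2l /=.
  have h := card_short_moved T rv.
  apply: leq_trans (leq_trans h _) => //; rewrite -sum1_card [leqRHS]big_mkcond /=.
  apply: leq_sum => a _; case: eqP => // e.
  by rewrite inE fv size_poly1 e; case: (T); rewrite size_poly1.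
rewrite [vec_count _ _]/= [alternations _]/=; have [TT'|TT'] := eqVneq (Some T') (Some T).
  by case: TT' => <-; rewrite addn0; exact: IHs.
have {TT'}T'E : T' = ~~ T by case: T T' TT' => -[].
rewrite {T'}T'E in IHs *.
set N := alternations (~~ T :: s); rewrite -[(alternations s + _)%N]/N addn1.
set n := size (fixed_coord T v).
have [n_gt0 _ _] := reachable_size T rv.
set short := [pred a | size (fixed_coord (~~ T) (shear T a v)) <= n]%N.
(* A letter leading away gives at most [8 ^ N], the exceptional one at most [16 * 8 ^ N]; the total
   is [(17 + 15) * 8 ^ N = 4 * 8 ^ N.+1]. *)
have bound a : (vec_count (~~ T :: s) (shear T a v) * 4 ^ n
    <= 8 ^ N + (15 * 8 ^ N) * (short a))%N.
  have rva := reachable_shear T a rv.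
  have := IHs (~~ T) _ rva; rewrite -/N; move: (vec_count _ _) => x.
  have [_ h1 h2] := reachable_size T rva; rewrite fixed_shear -/n in h1 h2.
  move=> h; rewrite inE; case: (leqP _ n) => hs.
    have : (4 ^ n <= 4 * 4 ^ size (fixed_coord (~~ T) (shear T a v)))%N.
      by rewrite -expnS leq_exp2l.
    by move=> /(leq_mul (leqnn x)); rewrite muln1; lia.
  have e : size (fixed_coord (~~ T) (shear T a v)) = n.+1 by lia.
  by rewrite e expnS in h; lia.
have hc : (#|short| <= 1)%N by exact: card_short_moved.
rewrite big_distrl /=; apply: leq_trans (leq_sum _ (fun a _ => bound a)) _.
rewrite big_split /= sum_nat_const card_F -big_distrr /=.
have -> : (\sum_a short a)%N = #|short| by rewrite -sum1_card [RHS]big_mkcond.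
by have := leq_mul (leqnn (15 * 8 ^ N)%N) hc; rewrite muln1 expnS; lia.
Qed.

Lemma vec_count_le s v : reachable v -> (vec_count s v <= 8 ^ alternations s)%N.
Proof.
case: s => [|T s] rv; first by rewrite /= leq_b1.
have := vec_count_weight T s rv; have [h _ _] := reachable_size T rv.
have : (4 ^ 1 <= 4 ^ size (fixed_coord T v))%N by rewrite leq_exp2l.
by move: (vec_count _ _) (8 ^ _)%N => x y; nia.
Qed.

Section LampLaw.
Variables (R : realType) (d : {poly F}).
Local Notation Gam := (cong_group d).
Local Notation AB := (free_product F F).

(** The switch set has 33 elements, the neutral one being common to A and B. Halving its mass
    between the two types makes the type of a switch a fair coin. *)
Definition letter_weight (a : F) : R := (2 - (a == 1%g)%:R) / 33.

Lemma letter_weight_ge0 a : 0 <= letter_weight a.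
Proof. by rewrite divr_ge0 // subr_ge0; case: (_ == _); rewrite ?ler1n ?ler0n. Qed.

Lemma letter_weight_le a : letter_weight a <= 2 / 33.
Proof. by rewrite ler_pM2r ?invr_gt0 // gerBl ler0n. Qed.

Lemma sum_letter_weight : \sum_a letter_weight a = 1.
Proof.
rewrite -mulr_suml sumrB sumr_const card_F (bigD1 (1%g : F)) // eqxx.
by rewrite big1 => [|a /negPf -> //]; rewrite /= addr0 -mulr_natr; lra.
Qed.

(** The probability that [g], multiplied on the right by random letters of the types in [s], becomes
    1. *)
Fixpoint lamp_law (s : seq bool) (g : Gam) : R :=
  if s is T :: s' then \sum_(a : F) letter_weight a * lamp_law s' (g * cong_emb d T a)%g
  else (g == 1%g)%:R.

Fixpoint lamp_count (s : seq bool) (g : Gam) : nat :=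
  if s is T :: s' then
    if ohead s' == Some T then lamp_count s' g
    else \sum_(a : F) lamp_count s' (g * cong_emb d T a)%g
  else g == 1%g.

Lemma lamp_count_inv T s g a :
  lamp_count (T :: s) (g * cong_emb d T a)%g = lamp_count (T :: s) g.
Proof.
elim: s T g a => [|T' s IHs] T g a; rewrite [LHS]/= [RHS]/=.
  rewrite [RHS](reindex_inj (mulgI a)) /=.
  by apply: eq_bigr => b _; rewrite cong_embM mulgA.
have [[->]|_] := eqVneq; first exact: IHs.
rewrite [RHS](reindex_inj (mulgI a)) /=.
by apply: eq_bigr => b _; rewrite cong_embM mulgA.
Qed.

Lemma lamp_law_ge0 s g : 0 <= lamp_law s g.
Proof.
elim: s g => [|T s IHs] g /=; first exact: ler0n.
by apply: sumr_ge0 => a _; rewrite mulr_ge0 ?letter_weight_ge0.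
Qed.

(** Each block costs one factor [2 / 33], the largest letter weight; its other letters average a
    function that they leave invariant ([lamp_count_inv]). *)
Lemma lamp_law_le_count s g :
  lamp_law s g <= (2 / 33) ^+ alternations s * (lamp_count s g)%:R.
Proof.
elim: s g => [|T s IHs] g; first by rewrite mul1r.
rewrite [lamp_law _ _]/= [alternations _]/= [lamp_count _ _]/=.
have [hs|_] := eqVneq (ohead s) (Some T).
  rewrite addn0 -[leRHS]mul1r -{1}sum_letter_weight mulr_suml.
  apply: ler_sum => a _; apply: ler_wpM2l; first exact: letter_weight_ge0.
  apply: le_trans (IHs _) _; case: s hs {IHs} => [//|T' s] [->].
  by rewrite lamp_count_inv.
rewrite addn1 exprS -mulrA natr_sum !mulr_sumr; apply: ler_sum => a _.
apply: ler_pM; [exact: letter_weight_ge0|exact: lamp_law_ge0|exact: letter_weight_le|].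
exact: IHs.
Qed.

Lemma lamp_count_le1 s g : (alternations s <= 1)%N -> (lamp_count s g <= 1)%N.
Proof.
elim: s g => [|T s IHs] g; first by rewrite /= leq_b1.
rewrite /=; have [_|hs] := eqVneq; first by rewrite addn0; exact: IHs.
case: s hs {IHs} => [_ _|T' s _] /=; last first.
  have : (0 < alternations (T' :: s))%N.
    elim: s T' => [//|T'' s IHs] T' /=; exact: leq_trans (IHs T'') (leq_addr _ _).
  by rewrite /=; lia.
case: (pickP [pred a | g * cong_emb d T a == 1]%g) => [a /= /eqP ga|none]; last first.
  by rewrite big1 // => a _; rewrite -[X in nat_of_bool X]/([pred a | _] a) none.
rewrite (bigD1 a) //= ga eqxx big1 // => b ba; apply/eqP; rewrite eqb0.
apply: contra ba => /eqP gb; apply/eqP/(@cong_emb_inj d T)/(@mulgI _ g).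
by rewrite ga gb.
Qed.

(** While sizes stay below that of [d], being congruent to the root means being the root. Here [n]
    bounds the present sizes, and each alternation adds at most one. *)
Lemma lamp_count_lift s x n :
  (size (act x (1, 1)%R).1 <= n)%N -> (size (act x (1, 1)%R).2 <= n)%N ->
  d = 0 \/ (0 < n)%N /\ (n + alternations s < size d)%N ->
  (lamp_count s (qproj (cong_kernel d) x) <= vec_count s (act x (1, 1)%R))%N.
Proof.
elim: s x n => [|T s IHs] x n hx1 hx2 hd.
  rewrite [lamp_count _ _]/= [vec_count _ _]/=.
  have [/cong_group_eqP[_ /(_ (1, 1)%R)]|//] := eqVneq.
  rewrite act1; case/andP=> h1 h2; suff -> : act x (1, 1)%R = (1, 1)%R by rewrite eqxx.
  have small (p : {poly F}) : (size p <= n)%N -> d %| p - 1 -> p = 1.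
    case: hd => [->|[n0 nd] pn dp]; first by rewrite dvd0p subr_eq0 => _ /eqP.
    apply/eqP; rewrite -subr_eq0; apply: contraTT dp => p0.
    apply/negP => /(dvdp_leq p0); apply/negP; rewrite -ltnNge.
    rewrite (leq_ltn_trans (size_polyD _ _)) // size_polyN size_poly1 gtn_max.
    rewrite /= addn0 in nd; rewrite (leq_ltn_trans pn nd); exact: leq_ltn_trans n0 nd.
  by rewrite [LHS]surjective_pairing (small _ hx1 h1) (small _ hx2 h2).
rewrite [lamp_count _ _]/= [vec_count _ _]/=; move: hd; rewrite [alternations _]/=.
case: eqP => hs hd.
  by apply: (IHs _ n); rewrite ?addn0 // in hd *.
apply: leq_sum => a _; rewrite -act_free_emb -actM /cong_emb -qproj_mulg.
have [h1 h2] := size_shear_le T a hx1 hx2.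
apply: (IHs _ n.+1); rewrite ?actM ?act_free_emb //.
by case: hd => [|[]]; [left|right; split=> //; lia].
Qed.

Lemma lamp_count_support s g : (0 < lamp_count s g)%N ->
  exists x, [/\ g = qproj (cong_kernel d) x, reachable (act x (1, 1)%R),
    (size (act x (1, 1)%R).1 <= (alternations s).+1)%N &
    (size (act x (1, 1)%R).2 <= (alternations s).+1)%N].
Proof.
elim: s g => [|T s IHs] g.
  rewrite [lamp_count _ _]/=; case: eqVneq => // -> _; exists 1%g; rewrite act1 size_poly1.
  by split=> //; exact: reachable1.
rewrite [lamp_count _ _]/= [alternations _]/=.
have [_ /IHs|_] := eqVneq; first by rewrite addn0.
rewrite lt0n sum_nat_eq0 negb_forall => /existsP[a].
rewrite implyTb -lt0n => /IHs[x [gx rx h1 h2]].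
exists (x * free_emb T a^-1)%g; rewrite actM act_free_emb addn1.
have [h1' h2'] := size_shear_le T a^-1%g h1 h2.
split=> //; last exact: reachable_shear.
by rewrite qproj_mulg -gx -[qproj _ (free_emb _ _)]/(cong_emb d T _) -mulgA -cong_embM
  mulgV multiplicative1 mulg1.
Qed.

(** A [g] that can return in [alternations s] letters is also that near to 1 ([lamp_count_support]);
    getting there and back explains the factor 2. *)
Lemma lamp_count_le s g : d = 0 \/ (2 * alternations s + 1 < size d)%N ->
  (lamp_count s g <= 8 ^ alternations s)%N.
Proof.
move=> hd; have [->//|/lamp_count_support[x [-> rx h1 h2]]] := posnP (lamp_count s g).
apply: leq_trans (vec_count_le s rx); apply: lamp_count_lift h1 h2 _.
by case: hd => [|h]; [left|right; split=> //; lia].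
Qed.

(* Words of length at most [2 L] are then not identified modulo [d]; for [L = 1] nothing is
   asked, as [A] and [B] embed. *)
Definition lamp_capacity (L : nat) : Prop :=
  [\/ d = 0, (2 * L + 1 < size d)%N | (L <= 1)%N].

(** Up to [L] alternations, each one contributes [8 * (2 / 33) <= 1 / 2]; later ones only average a
    bound already obtained. *)
Lemma lamp_law_le L s g : lamp_capacity L ->
  lamp_law s g <= 2^-1 ^+ minn (alternations s) L.
Proof.
move=> cap; elim: s g => [|T s IHs] g; first by rewrite min0n expr0 /= lern1 leq_b1.
have [Ls|sL] := leqP L (alternations s).
  have -> : minn (alternations (T :: s)) L = minn (alternations s) L.
    by rewrite /= !(minn_idPr _) // (leq_trans Ls) // leq_addr.
  rewrite -[leRHS]mul1r -{1}sum_letter_weight mulr_suml; apply: ler_sum => a _.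
  by apply: ler_wpM2l; [exact: letter_weight_ge0|exact: IHs].
have TsL : (alternations (T :: s) <= L)%N by rewrite /=; case: (_ != _) => /=; lia.
rewrite (minn_idPl TsL); apply: le_trans (lamp_law_le_count _ _) _.
set N := alternations _ in TsL *.
have cnt : (lamp_count (T :: s) g <= 8 ^ N)%N.
  case: cap => [d0|hd|L1]; [by apply: lamp_count_le; left| |].
    by apply: lamp_count_le; right; rewrite -/N; lia.
  by apply: leq_trans (lamp_count_le1 _ _) _; rewrite ?expn_gt0 // -/N; lia.
apply: le_trans (_ : (2 / 33) ^+ N * (8 ^ N)%:R <= _).
  by rewrite ler_wpM2l ?exprn_ge0 ?divr_ge0 // ler_nat.
by rewrite natrX -exprMn lerXn2r ?nnegrE //; lra.
Qed.

End LampLaw.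

(** * The walk on a wreath product *)

Arguments lamp_law : simpl never.
Arguments letter_weight : simpl never.

Definition step : Type := (bool + bool * F)%type.
HB.instance Definition _ := Finite.on step.

Section WreathWalk.
Variables (R : realType) (d : {poly F}) (k : nat).
Local Notation Gam := (cong_group d).
Local Notation Wr := (wreath Gam).

Definition step_weight (l : step) : R :=
  match l with inl _ => 4^-1 | inr (_, a) => 4^-1 * letter_weight R a end.

Lemma step_weight_ge0 l : 0 <= step_weight l.
Proof.
have h : 0 <= 4^-1 :> R by rewrite invr_ge0 ler0n.
by case: l => [b|[T a]] //=; rewrite mulr_ge0 ?letter_weight_ge0.
Qed.

Lemma sum_step (h : step -> R) : \sum_l step_weight l * h l =
  4^-1 * (h (inl true) + h (inl false)
    + \sum_(a : F) letter_weight R a * h (inr (true, a))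
    + \sum_(a : F) letter_weight R a * h (inr (false, a))).
Proof.
rewrite big_sumType /= big_bool /=.
have -> : \sum_(p : bool * F) step_weight (inr p) * h (inr p) =
    \sum_(T : bool) \sum_(a : F) 4^-1 * (letter_weight R a * h (inr (T, a))).
  by rewrite pair_bigA; apply: eq_bigr => -[T a] _ /=; rewrite -mulrA.
by rewrite big_bool /= -!mulr_sumr -!mulrDr !addrA.
Qed.

Lemma sum_step_weight : \sum_l step_weight l = 1.
Proof.
under eq_bigr => l _ do rewrite -[step_weight l]mulr1.
rewrite (sum_step (fun=> 1)); under eq_bigr => a _ do rewrite mulr1.
by rewrite sum_letter_weight; lra.
Qed.

Definition step_wreath (l : step) : Wr :=
  match l with
  | inl b => if b then wtrans Gam else (wtrans Gam)^-1%g
  | inr (T, a) => wlamp (if T then 0 else k%:Z) (cong_emb d T a)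
  end.

Definition average (Theta : Wr -> R) (u : Wr) : R :=
  \sum_l step_weight l * Theta (u * step_wreath l)%g.

Lemma average_le (Th1 Th2 : Wr -> R) m u :
  (forall v, Th1 v <= Th2 v) -> iter m average Th1 u <= iter m average Th2 u.
Proof.
move=> h; elim: m u => [//|m IHm] u /=; apply: ler_sum => l _.
by rewrite ler_wpM2l ?step_weight_ge0.
Qed.

Lemma average_cst c m u : iter m average (fun=> c) u = c.
Proof.
elim: m u => [//|m IHm] u /=; rewrite /average.
by under eq_bigr => l _ do rewrite IHm; rewrite -mulr_suml sum_step_weight mul1r.
Qed.

Lemma average_comb (Th0 Th1 Th2 Th3 Th4 : Wr -> R) m u :
  (forall v, Th0 v = 4^-1 * (Th1 v + Th2 v + Th3 v + Th4 v)) ->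
  iter m average Th0 u = 4^-1 * (iter m average Th1 u + iter m average Th2 u
    + iter m average Th3 u + iter m average Th4 u).
Proof.
move=> h; elim: m u => [//|m IHm] u /=; rewrite /average -!big_split mulr_sumr /=.
by apply: eq_bigr => l _; rewrite IHm; ring.
Qed.

(** Inversion turns left division by the letters into right multiplication, under which lamps are
    updated at the walker. *)
Lemma walk_prob_le_average (G : groupType) (phi : {multiplicative G -> Wr})
    (ev : step -> G) (Theta : Wr -> R) m x :
  (forall l, phi (ev l) = step_wreath l) ->
  (forall u, 0 <= Theta u) -> 1 <= Theta 1%g ->
  walk_prob step_weight ev m x <= iter m average Theta (phi x)^-1%g.
Proof.
move=> phiE Th0 Th1; elim: m x => [|m IHm] x /=.
  by have [->|_] := eqVneq; rewrite ?multiplicative1 ?invg1.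
apply: ler_sum => l _; rewrite ler_wpM2l ?step_weight_ge0 //.
by apply: le_trans (IHm _) _; rewrite gmulfM multiplicativeV phiE invgM invgK.
Qed.

Definition upd (H : int -> seq bool) (x : int) (T : bool) : int -> seq bool :=
  fun y => if y == x then T :: H y else H y.

Variable win : seq int.
Hypothesis win_uniq : uniq win.

(** Once the types and places of the switches are fixed, the letters at different lamps are
    independent, hence a product. Lamps outside the finite window [win] are ignored, which can only
    enlarge the bound. *)
Definition profile (z : int) (H : int -> seq bool) (u : Wr) : R :=
  (u.2 == z)%:R * \prod_(x <- win) lamp_law R (H x) (u.1 x).

Lemma profile_ge0 z H u : 0 <= profile z H u.
Proof. by rewrite mulr_ge0 ?ler0n // prodr_ge0 // => x _; exact: lamp_law_ge0. Qed.

Lemma profile1 : profile 0 (fun=> [::]) 1%g = 1.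
Proof.
rewrite /profile eqxx mul1r big1 // => x _ /=.
by rewrite /lamp_law woneE eqxx.
Qed.

Lemma lamp_law_cons T s (g : Gam) : lamp_law R (T :: s) g =
  \sum_(a : F) letter_weight R a * lamp_law R s (g * cong_emb d T a)%g.
Proof. by []. Qed.

Lemma profile_switch z H T (p : int) u :
  \sum_(a : F) letter_weight R a * profile z H (u * wlamp p (cong_emb d T a))%g =
  profile z (upd H (z + p) T) u.
Proof.
have lampE a x : (u * wlamp p (cong_emb d T a))%g.1 x =
    (u.1 x * if x == (u.2 + p)%R then cong_emb d T a else 1)%g.
  by rewrite wmulE wlampE subr_eq addrC.
have lamp2 a : (u * wlamp p (cong_emb d T a))%g.2 = u.2 by rewrite /= addr0.
rewrite /profile; have [uz|uz] := eqVneq u.2 z; last first.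
  by rewrite mul0r big1 // => a _; rewrite lamp2 (negPf uz) mul0r mulr0.
transitivity (\sum_(a : F) letter_weight R a *
    \prod_(x <- win) lamp_law R (H x) ((u * wlamp p (cong_emb d T a))%g.1 x)).
  by apply: eq_bigr => a _; rewrite lamp2 uz eqxx mul1r.
rewrite mul1r; have [zp|zp] := boolP ((z + p)%R \in win).
  have splitE (h : int -> R) : \prod_(x <- win) h x
      = h (z + p)%R * \prod_(x <- win | x != (z + p)%R) h x by exact: bigD1_seq.
  rewrite [RHS]splitE {1}/upd eqxx lamp_law_cons mulr_suml.
  apply: eq_bigr => a _; rewrite -(mulrA (letter_weight R a)); congr (_ * _).
  rewrite [LHS]splitE lampE uz eqxx; congr (_ * _).
  by apply: eq_bigr => x /negPf xzp; rewrite lampE /upd uz xzp mulg1.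
transitivity (\sum_(a : F) letter_weight R a * \prod_(x <- win) lamp_law R (H x) (u.1 x)).
  apply: eq_bigr => a _; congr (_ * _); apply: eq_big_seq => x xW.
  rewrite lampE uz; case: eqP => [xzp|_]; last by rewrite mulg1.
  by rewrite -xzp xW in zp.
rewrite -mulr_suml sum_letter_weight mul1r; apply: eq_big_seq => x xW.
by rewrite /upd; case: eqP => // xzp; rewrite -xzp xW in zp.
Qed.

(** A mixture of profiles: the random letters are integrated out, and only the position and the
    histories of types remain random. *)
Lemma average_profile z H u : average (profile z H) u =
  4^-1 * (profile (z - 1) H u + profile (z + 1) H u
    + profile z (upd H z true) u + profile z (upd H (z + k%:Z) false) u).
Proof.
have := profile_switch z H true 0 u; rewrite addr0 => <-.
rewrite -profile_switch /average sum_step; congr (_ * (_ + _ + _ + _)).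
  rewrite /profile; congr ((nat_of_bool _)%:R * _).
    by rewrite /= [RHS]eq_sym subr_eq eq_sym.
  by apply: eq_bigr => x _; rewrite wmulE woneE mulg1.
rewrite /profile; congr ((nat_of_bool _)%:R * _); first by rewrite /= subr_eq.
by apply: eq_bigr => x _; rewrite wmulE winvE woneE invg1 mulg1.
Qed.

End WreathWalk.

(** * Upper bound on the return probability *)

Section ZInterval.
Variable b : nat.

Definition zinterval : seq int := [seq i%:Z - b%:Z | i <- iota 0 (2 * b).+1].

Lemma zinterval_uniq : uniq zinterval.
Proof. by rewrite map_inj_uniq ?iota_uniq // => i j /addIr []. Qed.

Lemma mem_zinterval (x : int) : (x \in zinterval) = (`|x| <= b)%N.
Proof.
apply/mapP/idP => [[i]|xb]; first by rewrite mem_iota => ? ->; lia.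
by exists (absz (x + b%:Z)); rewrite ?mem_iota; lia.
Qed.

End ZInterval.

(** * A quadratic barrier in the distance to a fresh switch *)

Section Barrier.
Variables (R : realType) (r : nat).
Hypothesis r_gt0 : (0 < r)%N.

Definition theta : R := (48 * r%:R ^+ 2)^-1.
(** A concave parabola, increasing on [[0, 3 r]]; [theta] makes its whole rise 9/48, less than what
    one halving gains. *)
Definition phi (n : nat) : R := 1 + theta * n%:R * (6 * r%:R - n%:R).
Definition rate : R := 1 - (120 * r%:R ^+ 2)^-1.

Let r1 : 1 <= r%:R :> R. Proof. by rewrite ler1n. Qed.
Let theta_gt0 : 0 < theta.
Proof. by rewrite invr_gt0 mulr_gt0 ?exprn_gt0 // ltr0n. Qed.
Let theta_r2 : theta * r%:R ^+ 2 = 48^-1.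
Proof. by rewrite /theta; field; rewrite pnatr_eq0; lia. Qed.
Let theta_r : theta * r%:R <= 48^-1.
Proof. by rewrite -theta_r2 expr2 mulrA ler_peMr // mulr_ge0 ?ltW // ltr0n. Qed.
Let theta_le : theta <= 48^-1.
Proof. by apply: le_trans theta_r; rewrite ler_peMr // ltW. Qed.
Let rateE : rate = 1 - (2 / 5) * theta.
Proof. by rewrite /rate /theta; field; rewrite pnatr_eq0; lia. Qed.

Lemma rate_ge0 : 0 <= rate. Proof. by rewrite rateE; have := theta_le; lra. Qed.

Lemma phi_le n : phi n <= 57 / 48.
Proof.
have h : n%:R * (6 * r%:R - n%:R) <= 9 * r%:R ^+ 2 :> R.
  by have := sqr_ge0 (n%:R - 3 * r%:R : R); rewrite expr2; nra.
rewrite /phi -mulrA; have := ler_wpM2l (ltW theta_gt0) h; rewrite [X in _ <= X -> _]mulrCA theta_r2; lra.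
Qed.

Lemma phi_homo m n : (m <= n <= 3 * r)%N -> phi m <= phi n.
Proof.
case/andP=> mn nr; rewrite /phi lerD2l -!mulrA ler_pM2l //.
have mn' : m%:R <= n%:R :> R by rewrite ler_nat.
have nr' : n%:R <= 3 * r%:R :> R by rewrite -natrM ler_nat.
by nra.
Qed.

Lemma phi_ge1 n : (n <= 3 * r)%N -> 1 <= phi n.
Proof. by move=> nr; have := @phi_homo 0 n nr; rewrite {1}/phi mulr0 mul0r addr0. Qed.

(** A move has probability 1/2 and the second difference is [- 2 * theta], so the average drops by
    [theta / 2], more than [(2 / 5) * theta * (57 / 48)]. *)
Lemma phi_superharmonic n : (n.+1 <= 2 * r)%N ->
  4^-1 * (phi n + phi n.+2) + 2^-1 * phi n.+1 <= rate * phi n.+1.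
Proof.
move=> nr; have := phi_le n.+1; rewrite rateE mulrBl mul1r => h.
have e : phi n + phi n.+2 = 2 * phi n.+1 - 2 * theta.
  by rewrite /phi -[n.+2]addn2 -[n.+1]addn1 !natrD; ring.
rewrite e; have t0 := theta_gt0; have := ler_wpM2l (ltW theta_gt0) h; lra.
Qed.

(** At the target both moves lead to distance 1, but one of the two switches gains a factor 1/2,
    which pays for the kink. *)
Lemma phi_origin :
  4^-1 * (phi 1 + phi 1 + 1 + 2^-1 * (57 / 48)) <= rate.
Proof. by rewrite rateE /phi mulr1; have := theta_r; have := theta_gt0; lra. Qed.

End Barrier.

(** * The supermartingale estimate *)

Section Lyapunov.
Variables (R : realType) (d : {poly F}) (k L r b : nat).
Hypotheses (capL : lamp_capacity d L) (kr : (k <= r)%N) (r_gt0 : (0 < r)%N).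
Local Notation Gam := (cong_group d).
Local Notation win := (zinterval (b + 2 * r)).
Local Notation history := (int -> seq bool).

Definition progress (H : history) : nat :=
  \sum_(x <- win) minn (alternations (H x)) L.

Definition target_lamp (y : int) (T : bool) : int := y + (if T then 0 else k%:Z).

Definition fresh (H : history) (x : int) (T : bool) : bool :=
  [&& x \in win, (alternations (H x) < L)%N & ohead (H x) != Some T].

Lemma progress_upd H x T : progress (upd H x T) = (progress H + fresh H x T)%N.
Proof.
rewrite /progress /fresh; have [xW|xW] := boolP (x \in win); last first.
  rewrite addn0; apply: eq_big_seq => y yW; rewrite /upd.
  by case: eqP => // yx; rewrite -yx yW in xW.
rewrite (bigD1_seq x) ?zinterval_uniq //= [in RHS](bigD1_seq x) ?zinterval_uniq //=.
rewrite [in LHS](eq_bigr (fun y => minn (alternations (H y)) L)); last first.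
  by move=> y /negPf yx; rewrite /upd yx.
rewrite {1}/upd eqxx /=.
by case: (ohead _ != _) => /=; rewrite ?andbT ?andbF; case: ltnP; lia.
Qed.

(** A switch that makes no progress leaves a fresh switch fresh: at the same lamp it only repeats
    the last type. *)
Lemma fresh_upd H x T x' T' :
  fresh H x T -> fresh H x' T' || fresh (upd H x' T') x T.
Proof.
rewrite /fresh /upd => /and3P[xW hx hT]; have [xx'|_] := eqVneq x x'; last first.
  by rewrite xW hx hT orbT.
rewrite -xx' xW hx /=; case: (eqVneq (ohead (H x)) (Some T')) => //= e.
by rewrite addn0 hx; rewrite e in hT.
Qed.

(** Consider the [r] lamps from [z + k] on. One with fewer than [L] alternations has a fresh type,
    performed from [x] or [x - k], both near [z]; if there is none, these lamps alone give progress
    [r * L]. *)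
Lemma exists_fresh H (z : int) : (`|z| <= b)%N -> (progress H < r * L)%N ->
  exists y T, fresh H (target_lamp y T) T /\ (`|z - y| <= 2 * r)%N.
Proof.
move=> zb; apply: contraPP => none; apply/negP; rewrite -leqNgt.
pose s := [seq z + k%:Z + i%:Z | i <- iota 0 r].
have s_win : {subset s <= win}.
  by move=> x /mapP[i]; rewrite mem_iota mem_zinterval => ? ->; lia.
have s_uniq : uniq s by rewrite map_inj_uniq ?iota_uniq // => i j /addrI [].
have s_full x : x \in s -> (L <= alternations (H x))%N.
  move=> xs; rewrite leqNgt; apply/negP => hx; apply: none.
  move/mapP: (xs) => [i]; rewrite mem_iota => ir xE.
  have [hT|hT] := eqVneq (ohead (H x)) (Some true).
    exists (x - k%:Z), false; rewrite /target_lamp subrK /fresh s_win // hx hT.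
    by split=> //; lia.
  by exists x, true; rewrite /target_lamp addr0 /fresh s_win // hx hT; split=> //; lia.
apply: leq_trans (_ : \sum_(x <- s) minn (alternations (H x)) L <= _)%N; last first.
  by apply: (@uniq_sub_le_big _ _ leq leqnn (fun x y => leq_addr y x)) => //; exact: zinterval_uniq.
rewrite big_seq (eq_bigr (fun=> L)) => [|x /s_full /minn_idPr //].
by rewrite -big_seq big_const_seq count_predT iter_addn_0 size_map size_iota mulnC.
Qed.

Local Notation phi := (phi R r).
Local Notation rate := (rate R r).
Local Notation walk m z H u := (iter m (average k) (profile R win z H) u).
Local Notation half := (2^-1 : R).

Lemma walk_le_progress m z H (u : wreath Gam) : walk m z H u <= half ^+ progress H.
Proof.
rewrite -[leRHS](average_cst k _ m u); apply: average_le => v.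
rewrite /profile -[leRHS]mul1r ler_pM ?ler0n ?prodr_ge0 //.
- by move=> x _; exact: lamp_law_ge0.
- by rewrite lern1 leq_b1.
rewrite -prodrXr; apply: ler_prod => x _.
by rewrite lamp_law_ge0 lamp_law_le.
Qed.

(** The condition [|z| + m <= b] keeps the walker in [[-b, b]] for the remaining [m] steps, so the
    lamps it needs stay in the window. *)
Definition near_bound m : Prop :=
  forall z H (u : wreath Gam) y T, (`|z| + m <= b)%N ->
  fresh H (target_lamp y T) T -> (`|z - y| <= 2 * r)%N ->
  walk m z H u <= rate ^+ m * half ^+ progress H * phi `|z - y|%N + half ^+ (r * L).

(** Either the progress has reached [r * L] and the additive term suffices, or a new target is
    chosen. *)
Lemma near_bound_any m z H (u : wreath Gam) c : near_bound m -> (`|z| + m <= b)%N ->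
  phi (2 * r) <= c ->
  walk m z H u <= rate ^+ m * half ^+ progress H * c + half ^+ (r * L).
Proof.
move=> IH zb cphi.
have coef_ge0 : 0 <= rate ^+ m * half ^+ progress H.
  by rewrite mulr_ge0 ?exprn_ge0 ?(rate_ge0 R r_gt0) // invr_ge0.
have [saturated|unsat] := leqP (r * L) (progress H).
  apply: le_trans (walk_le_progress _ _ _ _) _.
  apply: le_trans (_ : half ^+ (r * L) <= _).
    by rewrite ler_wiXn2l // ?invr_ge0 // invf_le1 // ler1n.
  rewrite lerDr mulr_ge0 //; apply: le_trans cphi; apply: le_trans ler01 _.
  by apply: phi_ge1; lia.
have [|y [T [fr zy]]] := exists_fresh (z := z) _ unsat; first by lia.
apply: le_trans (IH _ _ _ _ _ zb fr zy) _; rewrite lerD2r ler_wpM2l //.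
by apply: le_trans cphi; apply: phi_homo; lia.
Qed.

Lemma near_boundP m : near_bound m.
Proof.
elim: m => [|m IHm] z H u y T zb fr zy.
  apply: le_trans (walk_le_progress _ _ _ _) _.
  rewrite expr0 mul1r -[leLHS]addr0 lerD ?exprn_ge0 ?invr_ge0 //.
  by rewrite ler_peMr ?exprn_ge0 ?invr_ge0 // phi_ge1 //; lia.
rewrite iterSr (average_comb _ _ _ (average_profile R k (zinterval_uniq _) z H)).
set A := rate ^+ m * half ^+ progress H; set E := half ^+ (r * L).
have A_ge0 : 0 <= A by rewrite mulr_ge0 ?exprn_ge0 ?(rate_ge0 R r_gt0) // invr_ge0.
(* When the walker gets farther than [2 * r], a nearer target replaces the old one; [phi] being
   increasing, this costs nothing. *)
have move_bound z' : (`|z'| + m <= b)%N -> (`|z' - y| <= (2 * r).+1)%N ->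
    walk m z' H u <= A * phi `|z' - y|%N + E.
  move=> zb' zy'; have [near|far] := leqP `|z' - y|%N (2 * r).
    exact: IHm fr near.
  by apply: near_bound_any => //; apply: phi_homo; lia.
have gain_bound x' T' : fresh H x' T' ->
    walk m z (upd H x' T') u <= A * (half * (57 / 48)) + E.
  move=> fr'; apply: le_trans (near_bound_any _ _ IHm _ (phi_le R r_gt0 _)) _; first by lia.
  by rewrite lerD2r progress_upd fr' addn1 exprS /A le_eqVlt; apply/orP; left; apply/eqP; ring.
(* Either the target survives the switch, or progress was made and the halving outweighs a change of
   target. *)
have switch_bound x' T' : walk m z (upd H x' T') u <= A * phi `|z - y|%N + E.
  have := fresh_upd x' T' fr; case fr' : (fresh H x' T') => /= fr''.
    apply: le_trans (gain_bound _ _ fr') _; rewrite lerD2r ler_wpM2l //.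
    by apply: le_trans (phi_ge1 R r_gt0 (_ : `|z - y| <= 3 * r)%N); [lra|lia].
  apply: le_trans (IHm _ _ _ _ _ _ fr'' zy) _; first by lia.
  by rewrite progress_upd fr' addn0.
rewrite exprS -!mulrA (mulrA (rate ^+ m)) -/A.
have b1 : walk m (z - 1) H u <= A * phi `|(z - 1)%R - y|%N + E by apply: move_bound; lia.
have b2 : walk m (z + 1) H u <= A * phi `|(z + 1)%R - y|%N + E by apply: move_bound; lia.
have b3 := switch_bound z true; have b4 := switch_bound (z + k%:Z) false.
case zyE : `|z - y|%N => [|n].
  have {zyE}zE : y = z by lia.
  move: b1 b2 b3 b4; rewrite zE subrr.
  have -> : `|(z - 1)%R - z|%N = 1%N by lia.
  have -> : `|(z + 1)%R - z|%N = 1%N by lia.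
  have -> : phi `|0%R|%N = 1 by rewrite /phi mulr0 mul0r addr0.
  have gain : walk m z (upd H z true) u <= A * (half * (57 / 48)) + E \/
      walk m z (upd H (z + k%:Z) false) u <= A * (half * (57 / 48)) + E.
    move: fr; rewrite zE /target_lamp; case: T => fr; [left|right].
      by rewrite addr0 in fr; exact: gain_bound fr.
    exact: gain_bound fr.
  have := ler_wpM2l A_ge0 (phi_origin R r_gt0).
  by case: gain => ?; lra.
move: b1 b2 b3 b4; rewrite zyE.
have := ler_wpM2l A_ge0 (@phi_superharmonic R r r_gt0 n _).
have [[-> ->]|[-> ->]] : `|(z - 1)%R - y|%N = n /\ `|(z + 1)%R - y|%N = n.+2 \/
    `|(z - 1)%R - y|%N = n.+2 /\ `|(z + 1)%R - y|%N = n by lia.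
  by move=> h; have {}h := h ltac:(lia); lra.
by move=> h; have {}h := h ltac:(lia); lra.
Qed.

End Lyapunov.

Lemma average_return_le (R : realType) d k L r m : lamp_capacity d L ->
  (k <= r)%N -> (0 < r)%N ->
  iter m (average k) (profile R (zinterval (m + 2 * r)) 0 (fun=> [::])) (1%g : wreath (cong_group d))
    <= 57 / 48 * rate R r ^+ m + 2^-1 ^+ (r * L).
Proof.
move=> capL kr r0.
have IH : @near_bound R d k L r m m by exact: near_boundP.
have := @near_bound_any R d k L r m capL kr r0 m 0 (fun=> [::]) 1%g (57 / 48) IH
  (leqnn m) (phi_le R r0 (2 * r)%N).
rewrite {1}/progress big1 => [|x _]; last by rewrite min0n.
by rewrite expr0 mulr1 [X in _ <= X + _ -> _]mulrC.
Qed.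

(** * The switch-or-walk measure *)

Section Diagonal.
Variable lev : nat -> option nat.
Local Notation D := (diag_data lev).
Local Notation Delta := (diagonal_product D).

Definition diag_hom (s : nat) (u : Delta) : wreath (lampG D s) := to_wreath D s (repr u).

Lemma diag_hom_class s x : diag_hom s (qproj _ x) = to_wreath D s x.
Proof.
have /qprojP/(_ s isT) := qreprK (qproj (kernels (fun s => isSome (Defs.shift D s)) (to_wreath D)) x).
rewrite gmulfM multiplicativeV => e.
by apply: (@mulgI _ (diag_hom s (qproj _ x))^-1%g); rewrite e mulVg.
Qed.

Lemma diag_homM s : {morph diag_hom s : u v / (u * v)%g}.
Proof.
move=> u v; rewrite -{1}(qreprK u) -{1}(qreprK v) -qproj_mulg diag_hom_class.
by rewrite gmulfM.
Qed.
HB.instance Definition _ s :=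
  isMultiplicative.Build Delta (wreath (lampG D s)) (diag_hom s) (diag_homM s).

Lemma diag_hom_inj (u v : Delta) : (forall s, diag_hom s u = diag_hom s v) -> u = v.
Proof.
rewrite -(qreprK u) -(qreprK v) => uv; apply/qprojP => s _.
by rewrite gmulfM multiplicativeV -!diag_hom_class uv mulVg.
Qed.

Definition diag_step (l : step) : Delta :=
  match l with
  | inl b => if b then diag_tau D else (diag_tau D)^-1%g
  | inr (T, a) => if T then diag_alpha (D := D) a else diag_beta (D := D) a
  end.

Arguments diag_step : simpl never.

Lemma diag_hom_step s l :
  diag_hom s (diag_step l) = step_wreath (data_modulus lev s) (data_shift s) l.
Proof.
have word x : diag_hom s (qproj _ (word_class x)) = eval_word (wtrans _)
    (lamp_at (embA D s) 0%:Z) (lamp_at (embB D s) (data_shift s)%:Z) x.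
  by rewrite diag_hom_class /to_wreath /= free_lift_word.
have tau : diag_hom s (diag_tau D) = wtrans _.
  by rewrite /diag_tau /freeZ word /eval_word big_seq1.
case: l => [b|[T a]]; rewrite /diag_step /=; last first.
  by case: T; rewrite /diag_alpha /diag_beta /freeA /freeB word /eval_word big_seq1.
by case: b; rewrite ?tau // (multiplicativeV (diag_hom s)) /= tau.
Qed.

Definition diag_pos (u : Delta) : int := (diag_hom 0 u).2.

Lemma diag_posM u v : diag_pos (u * v)%g = diag_pos u + diag_pos v.
Proof. by rewrite /diag_pos diag_homM. Qed.

Lemma diag_pos_step l :
  diag_pos (diag_step l) = if l is inl b then (if b then 1 else -1) else 0.
Proof. by rewrite /diag_pos diag_hom_step; case: l => [[]|[[] a]]. Qed.

Lemma lamp_step s T a :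
  diag_hom s (diag_step (inr (T, a))) =
  wlamp (if T then 0 else (data_shift s)%:Z) (cong_emb (data_modulus lev s) T a).
Proof. by rewrite diag_hom_step. Qed.

(** In factor 0 both types switch the lamp at 0, with values in A x B, where type and letter can be
    read off. *)
Lemma diag_step_lamp_inj T T' a a' :
  diag_step (inr (T, a)) = diag_step (inr (T', a')) ->
  a = a' /\ (T = T' \/ a = 1%g).
Proof.
pose val (w : wreath (cong_group (data_modulus lev 0))) := cong_proj (w.1 0).
move=> /(congr1 (fun u => val (diag_hom 0 u))); rewrite !lamp_step /val.
have -> : (if T then 0 else (data_shift 0)%:Z) = 0 by case: T.
have -> : (if T' then 0 else (data_shift 0)%:Z) = 0 by case: T'.
rewrite !wlampE eqxx !cong_proj_emb.
by case: T T' => -[] [] //; [move=> ->|move=> -> <-|move=> <- ->|move=> ->];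
  split; auto.
Qed.

Lemma diag_step1 T : diag_step (inr (T, 1%g)) = 1%g.
Proof.
have -> : 1%g = qproj (kernels (fun s => isSome (Defs.shift D s)) (to_wreath D)) 1%g.
  by rewrite multiplicative1.
by rewrite /diag_step; case: T; congr (qproj _ _); apply/word_classP; [exact: word_A1|exact: word_B1].
Qed.

Lemma mem_switch_set (y : Delta) :
  reflect (exists T a, y = diag_step (inr (T, a))) (y \in switch_set D).
Proof.
rewrite mem_undup mem_cat; apply: (iffP orP) => [[]/codomP[a ->]|[[] [a ->]]].
- by exists true, a.
- by exists false, a.
- by left; exact: codom_f.
- by right; exact: codom_f.
Qed.

(** A nonneutral element is given by one letter of weight 2, the neutral one by two letters of
    weight 1. *)
Lemma switch_set_count (y : Delta) :
  (2 * (y \in switch_set D) =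
   \sum_(T : bool) \sum_(a : F) (2 - (a == 1%g)) * (y == diag_step (inr (T, a))))%N.
Proof.
have sum0 T (x : Delta) : (forall a, x != diag_step (inr (T, a))) ->
    (\sum_(a : F) (2 - (a == 1%g)) * (x == diag_step (inr (T, a))) = 0)%N.
  by move=> yT; rewrite big1 // => a _; rewrite (negPf (yT a)) muln0.
have [/mem_switch_set[T [a ->]]|yS] := boolP (y \in switch_set D); last first.
  rewrite big1 // => T _; apply: sum0 => a; apply: contra yS => /eqP ->.
  by apply/mem_switch_set; exists T, a.
have sumE T' b : diag_step (inr (T, a)) = diag_step (inr (T', b)) ->
    (\sum_(c : F) (2 - (c == 1%g)) * (diag_step (inr (T, a)) == diag_step (inr (T', c)))
     = 2 - (b == 1%g))%N.
  move=> ->; rewrite (bigD1 b) //= eqxx muln1 big1 ?addn0 // => c cb.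
  case: (diag_step (inr (T', b)) =P _) => [/diag_step_lamp_inj[bc _]|_]; last by rewrite muln0.
  by rewrite bc eqxx in cb.
rewrite (bigD1 T) //= (sumE T a) // (big_pred1 (~~ T)) => [|T']; last first.
  by case: T T' {sumE} => -[].
have [a1|a1] := eqVneq a 1%g.
  by rewrite (sumE (~~ T) 1%g) ?a1 ?diag_step1 ?eqxx.
rewrite sum0 // => b; apply/eqP => /diag_step_lamp_inj[_ [TT|/eqP]]; last exact/negP.
by move: TT; case: (T).
Qed.

Lemma size_switch_set : size (switch_set D) = 33%N.
Proof.
apply/eqP; rewrite -(eqn_pmul2l (isT : 0 < 2)%N) -sum1_size big_distrr /=.
rewrite big_seq (eq_bigr (fun y => 2 * (y \in switch_set D)))%N => [|y ->//].
rewrite -big_seq (eq_bigr _ (fun y _ => switch_set_count y)) exchange_big /=.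
have card_letters T : (\sum_(y <- switch_set D) \sum_(a : F)
    (2 - (a == 1%g)) * (y == diag_step (inr (T, a))) = 33)%N.
  rewrite exchange_big /= (eq_bigr (fun a => 2 - (a == 1%g)))%N => [|a _].
    rewrite (bigD1 (1%g : F)) //= (eq_bigr (fun=> 2%N)) => [|a /negPf -> //].
    rewrite sum_nat_const cardC1 card_F.
    by [].
  rewrite -big_distrr /= (bigD1_seq (diag_step (inr (T, a)))) ?undup_uniq //=.
    by rewrite eqxx big1 ?muln1 // => y /negPf ->.
  by apply/mem_switch_set; exists T, a.
by rewrite big_bool /= !card_letters.
Qed.

Section Measure.
Variable R : realType.

Lemma switch_or_walk_letters (y : Delta) :
  switch_or_walk R D y = \sum_l step_weight R l * (y == diag_step l)%:R.
Proof.
rewrite sum_step /switch_or_walk /walk_measure /switch_measure size_switch_set.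
have := congr1 (fun n => n%:R : R) (switch_set_count y).
rewrite natrM big_bool natrD !natr_sum => h.
have scale T : \sum_(a : F) letter_weight R a * (y == diag_step (inr (T, a)))%:R
    = 33^-1 * \sum_(a : F) ((2 - (a == 1%g)) * (y == diag_step (inr (T, a))))%N%:R.
  rewrite mulr_sumr; apply: eq_bigr => a _; rewrite /letter_weight natrM natrB ?leq_b1 //.
    by ring.
  by case: (_ == _).
move: h; rewrite !scale /diag_step; lra.
Qed.

Local Notation prob := (walk_prob (step_weight R) diag_step).

Lemma convolution_powerE m (x : Delta) :
  convolution_power (switch_or_walk R D) m x = prob m x.
Proof. exact/convolution_power_letters/switch_or_walk_letters. Qed.

Lemma diag_return_le s L r m : lamp_capacity (data_modulus lev s) L ->
  (data_shift s <= r)%N -> (0 < r)%N ->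
  prob m 1%g <= 57 / 48 * rate R r ^+ m + 2^-1 ^+ (r * L).
Proof.
move=> cap kr r0; apply: le_trans (average_return_le _ _ cap kr r0).
have -> : 1%g = (diag_hom s 1%g)^-1%g by rewrite multiplicative1 invg1.
apply: (walk_prob_le_average (phi := diag_hom s)) => [l|u|].
- exact: diag_hom_step.
- exact: profile_ge0.
- by rewrite profile1.
Qed.

(** Moves change the position and switches do not, and each kind has probability 1/2. This will
    absorb the constants of [diag_return_le]. *)
Lemma walk_prob_le_half m (x : Delta) : prob m.+1 x <= 2^-1.
Proof.
elim: m x => [|m IHm] x; last first.
  rewrite [prob _ _]/= -[leRHS]mul1r -{1}(sum_step_weight R) mulr_suml.
  by apply: ler_sum => l _; apply: ler_wpM2l; [exact: step_weight_ge0|exact: IHm].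
have far l : diag_pos (diag_step l) != diag_pos x -> ((diag_step l)^-1 * x == 1)%g%:R = 0 :> R.
  move=> lx; case: eqP => // lx1.
  by rewrite -[x](mulVKg (diag_step l)) lx1 mulg1 eqxx in lx.
rewrite [prob _ _]/= (sum_step (fun l => ((diag_step l)^-1 * x == 1)%g%:R : R)).
have [x0|x0] := eqVneq (diag_pos x) 0.
  rewrite !far ?diag_pos_step ?x0 //.
  suff h T : \sum_(a : F) letter_weight R a * ((diag_step (inr (T, a)))^-1 * x == 1)%g%:R <= 1.
     by have := h true; have := h false; lra.
  rewrite -[leRHS](sum_letter_weight R); apply: ler_sum => a _.
  by rewrite ler_piMr ?letter_weight_ge0 // lern1 leq_b1.
rewrite !big1 => [|a _|a _]; try by rewrite far ?mulr0 // diag_pos_step eq_sym.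
have h (b : bool) : b%:R <= 1 :> R by rewrite lern1 leq_b1.
by have := h ((diag_step (inl true))^-1 * x == 1)%g;
   have := h ((diag_step (inl false))^-1 * x == 1)%g; lra.
Qed.

End Measure.
End Diagonal.

(** * Lower bound on the return probability *)

Lemma card_depfun_index (i : nat) (m : nat) (dim : nat -> nat) :
  #|{: {s : 'I_i & ('I_m * 'I_(dim s))%type}}| = (m * \sum_(s < i) dim s)%N.
Proof.
rewrite card_tagged sumnE big_map big_enum big_distrr /=.
by apply: eq_bigr => s _; rewrite card_prod !card_ord.
Qed.

Definition coef_label (x : free_product F F) (j : nat) : F * F * F * F :=
  ((act x (1, 0)).1`_j, (act x (1, 0)).2`_j, (act x (0, 1)).1`_j, (act x (0, 1)).2`_j).

Lemma dvd_Xn_coef n (p q : {poly F}) :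
  (forall j, (j < n)%N -> p`_j = q`_j) -> 'X^n %| p - q.
Proof.
move=> pq; rewrite -[p - q](poly_take_drop n); apply: dvdp_add; last exact: dvdp_mull.
suff -> : take_poly n (p - q) = 0 by exact: dvdp0.
apply/polyP => j; rewrite coef_take_poly coef0 coefB; case: ltnP => // jn.
by rewrite pq // subrr.
Qed.

(** The action is linear ([actE]), so modulo ['X^n] it is known from the first [n] coefficients of
    four matrix entries. *)
Lemma coef_label_inj d n (u v : cong_group d) : d = 'X^n -> cong_proj u = cong_proj v ->
  (forall j, (j < n)%N -> coef_label (repr u) j = coef_label (repr v) j) -> u = v.
Proof.
move=> dE; subst d => puv luv; rewrite -(qreprK u) -(qreprK v); apply/cong_group_eqP; split=> //.
move=> w; rewrite (actE (repr u)) (actE (repr v)).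
have lin (a b a' b' : {poly F}) : 'X^n %| a - a' -> 'X^n %| b - b' ->
    'X^n %| (w.1 * a + w.2 * b) - (w.1 * a' + w.2 * b').
  move=> ha hb; rewrite opprD addrACA -!mulrBr.
  by apply: dvdp_add; apply: dvdp_mull.
have d1 : 'X^n %| (act (repr u) (1, 0)).1 - (act (repr v) (1, 0)).1.
  by apply: dvd_Xn_coef => j /luv[].
have d2 : 'X^n %| (act (repr u) (1, 0)).2 - (act (repr v) (1, 0)).2.
  by apply: dvd_Xn_coef => j /luv[].
have d3 : 'X^n %| (act (repr u) (0, 1)).1 - (act (repr v) (0, 1)).1.
  by apply: dvd_Xn_coef => j /luv[].
have d4 : 'X^n %| (act (repr u) (0, 1)).2 - (act (repr v) (0, 1)).2.
  by apply: dvd_Xn_coef => j /luv[].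
by apply/andP; split; apply: lin.
Qed.

Section Return.
Variable lev : nat -> option nat.
Local Notation D := (diag_data lev).
Local Notation Delta := (diagonal_product D).

Local Notation lamp s u x := ((diag_hom (lev := lev) s u).1 x : cong_group (data_modulus lev s)).
Local Notation emb s := (cong_emb (data_modulus lev s)).
Local Notation shiftz s := ((data_shift s)%:Z).

Definition lamp_proj s (u : Delta) (x : int) : F * F := cong_proj (lamp s u x).

Definition switch_factor s (pos x : int) (l : step) : cong_group (data_modulus lev s) :=
  if l is inr (T, a) then
    if x == pos + (if T then 0 else shiftz s) then emb s T a else 1%g
  else 1%g.

Lemma lamp_mul_step s u l x :
  lamp s (u * diag_step lev l)%g x =
  (lamp s u x * switch_factor s (diag_hom s u).2 x l)%g.
Proof.
rewrite diag_homM diag_hom_step wmulE; congr (_ * _)%g.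
case: l => [[]|[T a]]; rewrite /step_wreath /switch_factor; first exact: woneE.
  by rewrite winvE woneE invg1.
by rewrite wlampE subr_eq addrC.
Qed.

(** In factor [s], A-switches reach only the lamps within [r] of 0 and B-switches those within [r]
    of [k_s]; a lamp reached by one kind only stays in that subgroup. Up to translation all factors
    see the same switches, so factor 0 knows the abelianised lamps. *)
Definition local_state (r : nat) (u : Delta) : Prop := forall s x,
  [/\ (diag_hom s u).2 = diag_pos u,
      lamp_proj s u x = ((lamp_proj 0 u x).1, (lamp_proj 0 u (x - shiftz s)).2),
      (r < `|x - shiftz s|)%N -> exists a, lamp s u x = emb s true a &
      (r < `|x|)%N -> exists b, lamp s u x = emb s false b].

Lemma local_state1 r : local_state r 1%g.
Proof.
move=> s x; have e s' y : lamp s' 1%g y = 1%g.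
  by rewrite (multiplicative1 (diag_hom s')) woneE.
rewrite /diag_pos /lamp_proj !e !cong_proj1 (multiplicative1 (diag_hom s))
  (multiplicative1 (diag_hom 0)); split=> // _;
  by exists 1%g; rewrite (multiplicative1 (cong_emb _ _)).
Qed.

Lemma local_state_step r u l : local_state r u -> (`|diag_pos u| <= r)%N ->
  local_state r (u * diag_step lev l)%g.
Proof.
move=> uS ur s x; have [us2 up ua ub] := uS s x; have [u02 _ _ _] := uS 0 x.
rewrite /lamp_proj !lamp_mul_step !cong_projM us2 u02; split.
- by rewrite /diag_pos !diag_homM /= us2 u02 !diag_hom_step; case: l => [[]|[]].
- rewrite -![cong_proj (lamp _ u _)]/(lamp_proj _ u _) up.
  case: l => [b|[[] a]] /=; rewrite ?addr0 ?cong_proj1.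
  + by congr (_, _); rewrite /= !mulg1.
  + by congr (_, _) => /=; do ![case: ifP => _]; rewrite ?cong_proj_emb ?cong_proj1 ?mulg1.
  + rewrite subr_eq; congr (_, _) => /=; do ![case: ifP => _];
      by rewrite ?cong_proj_emb ?cong_proj1 ?mulg1.
- move=> xr; have [a ->] := ua xr; case: l => [b|[[] a']] /=; first by exists a; rewrite mulg1.
    case: ifP => _; last by exists a; rewrite mulg1.
    by exists (a * a')%g; rewrite cong_embM.
  by case: eqP => [xE|_]; [lia|exists a; rewrite mulg1].
- move=> xr; have [a ->] := ub xr; case: l => [b|[[] a']] /=; first by exists a; rewrite mulg1.
    by case: eqP => [xE|_]; [lia|exists a; rewrite mulg1].
  case: ifP => _; last by exists a; rewrite mulg1.
  by exists (a * a')%g; rewrite cong_embM.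
Qed.

Lemma local_state_out r u x : local_state r u -> (r < `|x|)%N -> lamp_proj 0 u x = 1%g.
Proof.
move=> uS xr; have [_ _ ua ub] := uS 0 x; rewrite subr0 in ua.
have [[a ea] [b eb]] := (ua xr, ub xr); rewrite /lamp_proj.
have : cong_proj (emb 0 true a) = cong_proj (emb 0 false b) by rewrite -ea -eb.
by rewrite ea !cong_proj_emb => -[-> _].
Qed.

(** * Counting the elements reached by a confined walk *)

Section Key.
Variables (r i : nat).
Hypothesis lev_fin : forall s, (s < i)%N -> lev s != None.
Hypothesis far_shift : forall s, (i <= s)%N -> (2 * r < data_shift s.+1)%N.

Definition level_dim (s : nat) : nat := odflt 0%N (lev s).

Definition window_pos (x : 'I_(2 * r).+1) : int := x%:Z - r%:Z.

Lemma window_posP (x : int) : (`|x| <= r)%N -> exists y, x = window_pos y.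
Proof.
move=> xr; have h : (absz (x + r%:Z)%R < (2 * r).+1)%N by lia.
by exists (Ordinal h); rewrite /window_pos /=; lia.
Qed.

Definition label_index : finType :=
  {s : 'I_i & ('I_(2 * r).+1 * 'I_(level_dim s))%type}.

Definition key_type : finType :=
  ('I_(2 * r).+1 * {ffun 'I_(2 * r).+1 -> F * F} *
   {ffun label_index -> F * F * F * F})%type.

Definition diag_key (u : Delta) : key_type :=
  (inord (absz (diag_pos u + r%:Z)%R),
   [ffun x => lamp_proj 0 u (window_pos x)],
   [ffun sxj : label_index => coef_label (repr (lamp (tag sxj).+1 u (window_pos (tagged sxj).1)))
                  (tagged sxj).2]).

(** A lamp that only one kind of switch reaches is determined by its projection. A lamp reached by
    both forces [k_s <= 2 * r], and then its matrix coefficients are part of the key. *)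
Lemma diag_key_inj u v : local_state r u -> local_state r v ->
  (`|diag_pos u| <= r)%N -> (`|diag_pos v| <= r)%N -> diag_key u = diag_key v -> u = v.
Proof.
move=> uS vS ur vr [/(congr1 val) posE /ffunP projE /ffunP labE].
have {}posE : diag_pos u = diag_pos v by move: posE; rewrite /= !inordK; lia.
have {}projE x : lamp_proj 0 u x = lamp_proj 0 v x.
  have [/window_posP[y ->]|xr] := leqP `|x| r; first by have := projE y; rewrite !ffunE.
  by rewrite !(local_state_out _ xr).
have projEs s x : lamp_proj s u x = lamp_proj s v x.
  have [_ -> _ _] := uS s x; have [_ -> _ _] := vS s x.
  by rewrite !projE.
apply: diag_hom_inj => s; apply: wreathP => [x|]; last first.
  by have [-> _ _ _] := uS s 0; have [-> _ _ _] := vS s 0.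
have [_ _ ua ub] := uS s x; have [_ _ va vb] := vS s x.
have := projEs s x; rewrite /lamp_proj.
have [xs|xs] := leqP `|x - (data_shift s)%:Z| r; last first.
  by have [a ->] := ua xs; have [b ->] := va xs; rewrite !cong_proj_emb => -[->].
have [xr|xr] := leqP `|x| r; last first.
  by have [a ->] := ub xr; have [b ->] := vb xr; rewrite !cong_proj_emb => -[->].
case: s {ua ub va vb} xs => [_|s xs] puv; first exact: cong_proj_inj.
have si : (s < i)%N by rewrite ltnNge; apply/negP => /far_shift; lia.
have [y xE] := window_posP xr.
have levE : data_modulus lev s.+1 = 'X^(level_dim s).
  by rewrite /= /level_dim; case: (lev s) (lev_fin si).
apply: (coef_label_inj levE puv) => j js; rewrite xE.
have := labE (Tagged (fun s : 'I_i => ('I_(2 * r).+1 * 'I_(level_dim s))%type)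
  (i := Ordinal si) (y, Ordinal js)).
by rewrite !ffunE.
Qed.

Lemma card_key_type : #|key_type| =
  ((2 * r).+1 * (17 ^ 2) ^ (2 * r).+1 *
   (17 ^ 4) ^ ((2 * r).+1 * \sum_(s < i) level_dim s))%N.
Proof.
rewrite !card_prod !card_ffun card_depfun_index !card_prod card_F.
by rewrite !card_ord -!mulnA.
Qed.

End Key.

(** * Survival of the walk in a ball *)

Section Survival.
Variables (R : realType) (r : nat).
Local Notation rad := (r.+1%:R : R).

(** A polynomial bump vanishing at distance [r.+1], where every exit from the ball lands, so that
    killing loses nothing. *)
Definition survival_fun (u : Delta) : R := (1 - ((diag_pos u)%:~R / rad) ^+ 2) ^+ 2.
Definition survival_rate : R := 1 - rad ^- 2 + 2^-1 * rad ^- 4.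
Definition in_ball (u : Delta) : bool := (`|diag_pos u| <= r)%N.

Let rad_gt0 : 0 < rad. Proof. exact: ltr0Sn. Qed.

(** With [q = rad ^- 2]: [1 - q + q ^+ 2 / 2] is at least [1 / (1 + 2 * q)], hence at least
    [expR (- (2 * q))]. *)
Lemma survival_rate_ge : expR (- (2 * rad ^- 2)) <= survival_rate.
Proof.
have -> : survival_rate = 1 - rad ^- 2 + 2^-1 * (rad ^- 2) ^+ 2.
  by rewrite exprVn -exprM.
have q_gt0 : 0 < rad ^- 2 by rewrite invr_gt0 exprn_gt0.
move: (rad ^- 2) q_gt0 => q q_gt0.
have e_gt0 := expR_gt0 (2 * q); have h := expR_ge1Dx (2 * q).
rewrite expRN -(ler_pM2l e_gt0) divff ?gt_eqF //.
apply: le_trans (_ : (1 + 2 * q) * (1 - q + 2^-1 * q ^+ 2) <= _).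
  rewrite -subr_ge0; have -> : (1 + 2 * q) * (1 - q + 2^-1 * q ^+ 2) - 1
    = q * ((q - 3 / 4) ^+ 2 + 7 / 16) by field.
  by rewrite mulr_ge0 ?addr_ge0 ?sqr_ge0 // ltW.
apply: ler_wpM2r h; have -> : 1 - q + 2^-1 * q ^+ 2 = 2^-1 * ((q - 1) ^+ 2 + 1) by field.
by rewrite mulr_ge0 ?addr_ge0 ?sqr_ge0.
Qed.

Lemma in_ball_ratio u : in_ball u -> ((diag_pos u)%:~R / rad) ^+ 2 <= 1 :> R.
Proof.
rewrite /in_ball => ur.
rewrite expr_div_n ler_pdivrMr ?exprn_gt0 // mul1r -[(_%:~R) ^+ 2]real_normK ?num_real //.
by rewrite lerXn2r ?nnegrE // -intr_norm pmulrn ler_int; lia.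
Qed.

Lemma survival_fun_le1 u : in_ball u -> survival_fun u <= 1.
Proof.
move/in_ball_ratio; rewrite /survival_fun; set x := _ / _; have := sqr_ge0 x.
by move: (x ^+ 2) => y y0 y1; rewrite expr_le1 //; lra.
Qed.

Lemma survival_fun_sub u : in_ball u ->
  survival_rate * survival_fun u <=
  \sum_(l | in_ball (u * diag_step lev l)%g)
    step_weight R l * survival_fun (u * diag_step lev l)%g.
Proof.
move=> ur; have zr := in_ball_ratio ur.
rewrite big_mkcond (eq_bigr (fun l => step_weight R l * survival_fun (u * diag_step lev l)%g)).
  rewrite sum_step; pose f (z : R) : R := (1 - (z / rad) ^+ 2) ^+ 2.
  set z : R := (diag_pos u)%:~R.
  have stay T : \sum_(a : F) letter_weight R a *
      survival_fun (u * diag_step lev (inr (T, a)))%g = f z.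
    under eq_bigr => a _ do rewrite /survival_fun diag_posM diag_pos_step addr0.
    by rewrite -mulr_suml sum_letter_weight mul1r.
  rewrite !stay /survival_fun !diag_posM !diag_pos_step -/z -/(f z) !intrD -/z -!/(f _).
  have rE : rad ^- 4 = (rad ^- 2) ^+ 2 by rewrite exprVn -exprM.
  rewrite /survival_rate rE /f !expr_div_n in zr *.
  have q_gt0 : 0 < rad ^- 2 by rewrite invr_gt0 exprn_gt0.
  have q_le1 : rad ^- 2 <= 1 by rewrite invf_le1 ?exprn_gt0 // exprn_ege1 // ler1n.
  move: (rad ^- 2) q_gt0 q_le1 => q q_gt0 q_le1; rewrite -subr_ge0.
  set D := (X in 0 <= X).
  (* The rate is chosen to give equality at [z = 0]; the other coefficients are nonnegative since
     [q <= 1]. *)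
  have -> : D = (q ^+ 2 + q ^+ 3) * z ^+ 2 + 2^-1 * q ^+ 3 * (2 - q) * z ^+ 4.
    by rewrite /D mulrN1z mulr1z; field.
  rewrite addr_ge0 // mulr_ge0 ?exprn_even_ge0 //.
    by rewrite addr_ge0 // exprn_ge0 // ltW.
  by rewrite !mulr_ge0 ?exprn_ge0 ?(ltW q_gt0) // subr_ge0; lra.
move=> l _; case: ifP => // /negbT out; rewrite /survival_fun expr_div_n.
have -> : (diag_pos (u * diag_step lev l)%g)%:~R ^+ 2 = rad ^+ 2 :> R.
  rewrite -[LHS]real_normK ?num_real // -intr_norm.
  have -> : `|diag_pos (u * diag_step lev l)%g| = r.+1%:Z :> int; last by [].
  move: out ur; rewrite /in_ball diag_posM diag_pos_step.
  by case: l => [[]|[]]; lia.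
by rewrite divff ?gt_eqF ?exprn_gt0 // subrr expr0n mulr0.
Qed.

End Survival.

Definition inv_step (l : step) : step :=
  match l with inl b => inl (~~ b) | inr (T, a) => inr (T, a^-1%g) end.

Lemma inv_stepK : involutive inv_step.
Proof. by case=> [b|[T a]] /=; rewrite ?negbK ?invgK. Qed.

Lemma step_weight_inv (R : realType) l : step_weight R (inv_step l) = step_weight R l.
Proof. by case: l => [//|[T a]] /=; rewrite /letter_weight invg_eq1. Qed.

Lemma diag_step_inv l : diag_step lev (inv_step l) = (diag_step lev l)^-1%g.
Proof.
case: l => [[]|[T a]] //; first by rewrite /diag_step /= invgK.
have stepM b c : diag_step lev (inr (T, (b * c)%g)) =
    (diag_step lev (inr (T, b)) * diag_step lev (inr (T, c)))%g.
  have stepE x : diag_step lev (inr (T, x)) = qproj _ (free_emb T x).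
    by rewrite /diag_step /free_emb; case: (T).
  by rewrite !stepE free_embM qproj_mulg.
apply: (@mulgI _ (diag_step lev (inr (T, a)))).
by rewrite -stepM !mulgV diag_step1.
Qed.

Lemma diag_return_ge (R : realType) r i t :
  (forall s, (s < i)%N -> lev s != None) ->
  (forall s, (i <= s)%N -> (2 * r < data_shift s.+1)%N) ->
  survival_rate R r ^+ (2 * t) <=
  #|key_type r i|%:R * walk_prob (step_weight R) (diag_step lev) (2 * t) 1%g.
Proof.
move=> lev_fin far.
set law := killed_law (step_weight R) (diag_step lev) (in_ball r).
have law_state m p : p \in law m -> local_state r p.2 /\ in_ball r p.2.
  elim: m p => [|m IHm] p /=.
    rewrite inE => /eqP -> /=; split; first exact: local_state1.
    by rewrite /in_ball /diag_pos (multiplicative1 (diag_hom 0)).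
  rewrite mem_filter => /andP[pr /allpairsP[[p' l] /= [/IHm[st ok] _ pE]]].
  by split=> //; rewrite pE; exact: local_state_step.
apply: le_trans (return_ge_killed_mass (step_weight_ge0 R) inv_stepK (step_weight_inv R)
  diag_step_inv (ok := in_ball r) (key := diag_key r i) _); last first.
  by move=> p p' /law_state[? ?] /law_state[? ?]; exact: diag_key_inj.
have rate_ge0 : 0 <= survival_rate R r.
  by apply: le_trans (survival_rate_ge R r); exact: expR_ge0.
rewrite mulnC exprM lerXn2r ?nnegrE ?exprn_ge0 //.
  by rewrite big_seq sumr_ge0 // => p /(killed_law_ge0 (step_weight_ge0 R)).
have := @killed_law_mass R _ _ _ (diag_step lev) (step_weight_ge0 R) (in_ball r)
  (survival_fun R r) _ t rate_ge0.
have -> : survival_fun R r 1%g = 1.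
  rewrite /survival_fun /diag_pos (multiplicative1 (diag_hom 0)).
  by rewrite mul0r expr0n subr0 expr1n.
rewrite mulr1.
move=> mass; apply: le_trans (mass _) _ => [m u /mapP[p /law_state[_ ok] ->]|].
  exact: survival_fun_sub.
rewrite !big_seq; apply: ler_sum => p pP.
rewrite ler_piMr ?(killed_law_ge0 (step_weight_ge0 R) pP) // survival_fun_le1 //.
by have [] := law_state _ _ pP.
Qed.

End Return.

(** * Choice of the lamp groups *)

Section LevelChoice.
Variable f : nat -> option nat.
Hypothesis f_homo : forall i e, f i = Some e -> forall j, (j <= i)%N ->
  exists2 e', f j = Some e' & (e' <= e)%N.

(** An exponent that is 0 or repeats the previous one gets modulus 1. Otherwise, as ['X^D] has size
    [D.+1], this is the least degree that meets the size clause of [lamp_capacity] for [2 ^ e]. *)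
Definition level_of (i : nat) : option nat :=
  if f i is Some e then
    if (e == 0%N) || ((0 < i)%N && (f i.-1 == Some e)) then Some 0%N
    else Some (2 * 2 ^ e).+1
  else None.

Lemma level_of_None i : (level_of i == None) = (f i == None).
Proof. by rewrite /level_of; case: (f i) => // e; case: ifP. Qed.

(** Exponents that count are strictly increasing, so the sum is geometric: [6 * 2 ^ e'] is at most
    [3 * 2 ^ e], and so is the new term. *)
Lemma sum_level_of i e : f i = Some e ->
  (\sum_(s < i.+1) level_dim level_of s <= 6 * 2 ^ e)%N.
Proof.
elim: i e => [|i IHi] e fi.
  rewrite big_ord_recl big_ord0 addn0 /level_dim /level_of fi /=.
  by case: ifP => _ /=; have := expn_gt0 2 e; lia.
rewrite big_ord_recr /=; have [e' fi' e'e] := f_homo fi (leqnSn i).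
apply: leq_trans (leq_add (IHi _ fi') (leqnn _)) _.
rewrite /level_dim /level_of fi /= fi'.
have [->|ne] := eqVneq e' e; first by rewrite eqxx orbT /= addn0.
have -> : (Some e' == Some e) = false by apply/eqP => -[ee]; rewrite ee eqxx in ne.
have : (2 ^ e'.+1 <= 2 ^ e)%N by rewrite leq_exp2l //; lia.
by rewrite orbF expnS; case: ifP => _ /=; have := expn_gt0 2 e; lia.
Qed.

(** The first index with exponent [e] carries the nontrivial group, with a smaller shift; for
    [e = 0] factor 0 will do. *)
Lemma level_of_capacity i e : f i = Some e \/ f i = None ->
  exists s, lamp_capacity (data_modulus level_of s) (2 ^ e) /\ (data_shift s <= 2 * 4 ^ i)%N.
Proof.
case=> fi; last first.
  exists i.+1; split=> //; apply: Or31.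
  by rewrite /= /level_of fi.
have [e0|e0] := posnP e; first by exists 0%N; split=> //; rewrite e0; apply: Or33.
have exj : exists j, (j <= i)%N && (f j == Some e) by exists i; rewrite leqnn fi eqxx.
case: (ex_minnP exj) => j /andP[ji /eqP fj] jmin; exists j.+1; split; last first.
  by rewrite /= leq_mul2l leq_exp2l.
apply: Or32; rewrite /= /level_of fj gtn_eqF //=.
have -> : (0 < j)%N && (f j.-1 == Some e) = false.
  apply/negP => /andP[j0 fj1]; have := jmin j.-1; rewrite fj1 andbT.
  by move=> /(_ _); lia.
by rewrite size_polyXn; lia.
Qed.

End LevelChoice.

(** * Realising the prescribed growth *)

Section Growth.
Variables (R : realType) (gamma : R -> R).
Hypothesis gamma_ge1 : forall x : R, 1 <= x -> 1 <= gamma x.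
Hypothesis gamma1 : gamma 1 = 1.
Hypothesis gamma_cube : forall x y : R, 1 <= x -> x <= y ->
  gamma x / x `^ (1 / 3) <= gamma y / y `^ (1 / 3).
Hypothesis gamma_lin : forall x y : R, 1 <= x -> x <= y -> x / gamma x <= y / gamma y.

(* With the optimal radius r = sqrt (t / gamma t) and lamp size l = gamma t / r one has
   gamma t = t / r^2 = r l; both r^2 and l^2 are nondecreasing in t. *)
Definition radius2 (t : nat) : R := t%:R / gamma t%:R.
Definition size2 (t : nat) : R := gamma t%:R ^+ 3 / t%:R.

Let t_ge1 t : (0 < t)%N -> 1 <= t%:R :> R. Proof. by rewrite ler1n. Qed.
Let gamma_gt0 t : (0 < t)%N -> 0 < gamma t%:R.
Proof. by move=> t0; apply: lt_le_trans (gamma_ge1 (t_ge1 t0)). Qed.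

Lemma radius2_homo t u : (0 < t)%N -> (t <= u)%N -> radius2 t <= radius2 u.
Proof. by move=> t0 tu; apply: gamma_lin; rewrite ?ler_nat // t_ge1. Qed.

Lemma size2_homo t u : (0 < t)%N -> (t <= u)%N -> size2 t <= size2 u.
Proof.
move=> t0 tu; have u0 := leq_trans t0 tu.
have cube x : (0 < x)%N -> size2 x = (gamma x%:R / x%:R `^ (1 / 3)) ^+ 3.
  move=> x0; rewrite expr_div_n.
  by rewrite -[X in _ = _ / X]powR_mulrn ?powR_ge0 // -powRrM mul1r mulVf // powRr1 ?ler0n.
rewrite !cube // lerXn2r ?nnegrE ?divr_ge0 ?powR_ge0 ?(ltW (gamma_gt0 _)) //.
by apply: gamma_cube; rewrite ?ler_nat // t_ge1.
Qed.

Lemma radius2_1 : radius2 1 = 1. Proof. by rewrite /radius2 gamma1 divr1. Qed.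
Lemma size2_1 : size2 1 = 1. Proof. by rewrite /size2 gamma1 expr1n divr1. Qed.

Lemma gamma_radius2 t : (0 < t)%N -> gamma t%:R = t%:R / radius2 t.
Proof.
move=> t0; rewrite /radius2 invf_div mulrC divfK //.
by rewrite pnatr_eq0 -lt0n.
Qed.

Lemma gamma_sqr t : (0 < t)%N -> gamma t%:R ^+ 2 = radius2 t * size2 t.
Proof.
move=> t0; rewrite /radius2 /size2; field.
by rewrite pnatr_eq0 -lt0n t0 gt_eqF ?gamma_gt0.
Qed.

(** In terms of square roots: radius below [4 ^ i.+1] and lamp size at least [2 ^ e]. *)
Definition level_reached (i e : nat) : Prop :=
  exists t, [/\ (0 < t)%N, radius2 t < 16 ^+ i.+1 & 4 ^+ e <= size2 t].

Lemma exp_bound (b x : R) : 2 <= b -> exists n, x < b ^+ n.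
Proof.
move=> b2; exists (Num.bound x); apply: lt_le_trans (upper_nthrootP (leqnn _)) _.
by rewrite lerXn2r ?nnegrE //; lra.
Qed.

Lemma exp_bracket (b x : R) : 2 <= b -> 1 <= x -> exists n, b ^+ n <= x < b ^+ n.+1.
Proof.
move=> b1 x1; have exn : exists n, x < b ^+ n by exact: exp_bound.
case: (ex_minnP exn) => [[|n]] xn nmin; first by move: xn; rewrite expr0 ltNge x1.
by exists n; rewrite xn andbT leNgt; apply/negP => /nmin; rewrite ltnn.
Qed.

Lemma level_reached0 i : level_reached i 0.
Proof.
exists 1%N; rewrite radius2_1 size2_1 expr0; split=> //.
by rewrite exprn_egt1 // ltr1n.
Qed.

Lemma level_reached_le i j e e' : (i <= j)%N -> (e' <= e)%N ->
  level_reached i e -> level_reached j e'.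
Proof.
move=> ij e'e [t [t0 rt st]]; exists t; split=> //.
  by apply: lt_le_trans rt _; rewrite ler_weXn2l // ler1n.
by apply: le_trans st; rewrite ler_weXn2l // ler1n.
Qed.

Lemma level_reached_top i :
  exists o, if o is Some e then level_reached i e /\ ~ level_reached i e.+1
            else forall e, level_reached i e.
Proof.
have [all|] := pselect (forall e, level_reached i e); first by exists None.
move=> /existsNP[n Hn].
have exn : exists n, `[< ~ level_reached i n >] by exists n; apply/asboolP.
case: (ex_minnP exn) => [[|e]] /asboolP He emin; first by case: He; exact: level_reached0.
exists (Some e); split=> //; apply: contrapT => H.
by have := emin e; rewrite ltnn => /(_ (introT (asboolP _) H)).
Qed.

(** [f i] is the largest exponent reached at stage [i], with [None] for infinity. *)
Lemma level_choice : exists f : nat -> option nat,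
  [/\ forall i e, f i = Some e -> level_reached i e /\ ~ level_reached i e.+1,
      forall i, f i = None -> forall e, level_reached i e &
      forall i e, f i = Some e -> forall j, (j <= i)%N ->
        exists2 e', f j = Some e' & (e' <= e)%N].
Proof.
have [f fP] := choice level_reached_top.
have fS i e : f i = Some e -> level_reached i e /\ ~ level_reached i e.+1.
  by move=> fi; have := fP i; rewrite fi.
have fN i : f i = None -> forall e, level_reached i e.
  by move=> fi; have := fP i; rewrite fi.
exists f; split=> // i e fi j ji; have [_ ie] := fS _ _ fi.
case fj : (f j) => [e'|]; last by case: ie; exact: level_reached_le ji (leqnn _) (fN _ fj _).
exists e' => //; rewrite leqNgt; apply/negP => ee'; case: ie.
by have [je _] := fS _ _ fj; exact: level_reached_le ji ee' je.
Qed.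

Section Bounds.
Variable f : nat -> option nat.
Hypothesis f_Some : forall i e, f i = Some e -> level_reached i e /\ ~ level_reached i e.+1.
Hypothesis f_None : forall i, f i = None -> forall e, level_reached i e.
Hypothesis f_homo : forall i e, f i = Some e -> forall j, (j <= i)%N ->
  exists2 e', f j = Some e' & (e' <= e)%N.
Variable t : nat.
Hypothesis t_gt0 : (0 < t)%N.

Local Notation g := (gamma t%:R).
Local Notation prob := (walk_prob (step_weight R) (diag_step (level_of f)) (2 * t) 1%g).

Let radius2_ge1 : 1 <= radius2 t.
Proof. by rewrite -radius2_1; exact: radius2_homo. Qed.

Let size2_ge1 : 1 <= size2 t.
Proof. by rewrite -size2_1; exact: size2_homo. Qed.

(** Once the radius at [t] has passed [4 ^ i.+1], the time at which [e] was reached precedes [t]. *)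
Lemma reached_before i e : 16 ^+ i.+1 <= radius2 t -> level_reached i e -> 4 ^+ e <= size2 t.
Proof.
move=> ti [u [u0 ui ue]]; apply: le_trans ue _; apply: size2_homo => //.
rewrite leqNgt; apply/negP => /ltnW tu.
by have := le_lt_trans (radius2_homo t_gt0 tu) (lt_le_trans ui ti); rewrite ltxx.
Qed.

Lemma prob_le : 0 < prob -> g / 720 <= - ln prob.
Proof.
move=> p_gt0.
have [i /andP[ti it]] := exp_bracket (b := 16) (x := radius2 t) ltac:(lra) radius2_ge1.
(* For finite [f i] this is its maximality; for [None] any capacity is available, so [e] is fitted
   to [size2 t]. *)
have [e [fe te]] : exists e, (f i = Some e \/ f i = None) /\ size2 t < 4 ^+ e.+1.
  case fi : (f i) => [e|].
    exists e; split; [by left|]; rewrite ltNge; apply/negP => te.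
    by have [_] := f_Some fi; apply; exists t.
  have [e /andP[_ te]] := exp_bracket (b := 4) (x := size2 t) ltac:(lra) size2_ge1.
  by exists e; split; [right|].
have [s [cap ks]] := level_of_capacity fe.
have r0 : (0 < 2 * 4 ^ i)%N by rewrite muln_gt0 expn_gt0.
have := diag_return_le R (2 * t) cap ks r0.
set p : R := prob in p_gt0 * => p_le.
have p_half : p <= 2^-1.
  by rewrite /p -(prednK (_ : 0 < 2 * t)%N) ?muln_gt0 // walk_prob_le_half.
set a : R := 4 ^+ i; set b : R := 2 ^+ e.
have a_gt0 : 0 < a by rewrite exprn_gt0 // ltr0n.
have b_gt0 : 0 < b by rewrite exprn_gt0 // ltr0n.
have g_gt0 : 0 < g := gamma_gt0 t_gt0.
have a2 : 16 ^+ i = a ^+ 2 by rewrite /a exprAC; congr (_ ^+ i); rewrite -natrX.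
have b2 : 4 ^+ e = b ^+ 2 by rewrite /b exprAC; congr (_ ^+ e); rewrite -natrX.
have gab : g <= 8 * a * b.
  have ab8 : 0 <= 8 * a * b by apply: ltW; rewrite !mulr_gt0.
  rewrite -(ler_sqr (ltW g_gt0) ab8) (gamma_sqr t_gt0).
  apply: le_trans (ler_pM _ _ (ltW it) (ltW te)) _; rewrite ?(le_trans ler01) //.
  by rewrite !exprS a2 b2 le_eqVlt; apply/orP; left; apply/eqP; ring.
have tga : g * a ^+ 2 <= t%:R.
  rewrite -a2 (gamma_radius2 t_gt0) mulrAC ler_pdivrMr ?(lt_le_trans ltr01) //.
  by rewrite ler_wpM2l.
have rE : (2 * 4 ^ i)%:R = 2 * a :> R by rewrite natrM natrX.
have E1 : rate R (2 * 4 ^ i) ^+ (2 * t) <= expR (- (g / 240)).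
  apply: le_trans (_ : expR (- (480 * a ^+ 2)^-1) ^+ (2 * t) <= _).
    rewrite lerXn2r ?nnegrE ?expR_ge0 ?rate_ge0 //.
    apply: le_trans (expR_ge1Dx _); rewrite /rate rE exprMn lerD2l lerN2.
    by rewrite le_eqVlt; apply/orP; left; apply/eqP; congr (_^-1); ring.
  rewrite -expRM_natl ler_expR mulrN lerN2 natrM.
  by rewrite ler_pdivlMr ?mulr_gt0 ?exprn_gt0 ?ltr0n //; lra.
have E2 : 2^-1 ^+ (2 * 4 ^ i * 2 ^ e) <= expR (- (g / 240)).
  apply: le_trans (_ : expR (- 2^-1) ^+ (2 * 4 ^ i * 2 ^ e) <= _).
    rewrite lerXn2r ?nnegrE ?expR_ge0 ?invr_ge0 //.
    by apply: le_trans (expR_ge1Dx _); lra.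
  rewrite -expRM_natl ler_expR natrM rE natrX -/b; lra.
set E := expR _ in E1 E2.
(* The factor [5 / 2] would spoil the bound for small [g]; two factors [p <= 1 / 2] absorb it,
   whence [720 = 3 * 240]. *)
have p3 : p ^+ 3 <= E.
  have -> : p ^+ 3 = p * (p * p) by ring.
  have pE : p <= 5 / 2 * E by have := expR_ge0 (- (g / 240)); rewrite -/E; lra.
  have pp : p * p <= 2^-1 * 2^-1 by rewrite ler_pM // ltW.
  have := ler_pM (ltW p_gt0) (mulr_ge0 (ltW p_gt0) (ltW p_gt0)) pE pp.
  by have := expR_ge0 (- (g / 240)); rewrite -/E; lra.
have : ln (p ^+ 3) <= ln E by rewrite ler_ln ?posrE ?exprn_gt0 ?expR_gt0.
by rewrite /E expRK lnXn // -mulr_natr; lra.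
Qed.

Lemma prob_ge : 0 < prob /\ - ln prob <= 1000 * g.
Proof.
have [i /andP[ti it]] := exp_bracket (b := 16) (x := radius2 t) ltac:(lra) radius2_ge1.
(* Otherwise every exponent would have been reached before [t], and [size2 t] would exceed all
   powers of 4. *)
have lev_fin s : (s < i)%N -> level_of f s != None.
  move=> si; rewrite level_of_None; apply/eqP => fs.
  have [n] := exp_bound (b := 4) (size2 t) ltac:(lra); apply/negP; rewrite -leNgt.
  apply: reached_before (f_None fs n); apply: le_trans ti.
  by rewrite ler_weXn2l // ler1n.
(* The largest [r] with [2 * r] below the shift [2 * 4 ^ i] of factor [i.+1]. *)
set r := (4 ^ i).-1; have r1 : r.+1 = (4 ^ i)%N by rewrite prednK // expn_gt0.
have far s : (i <= s)%N -> (2 * r < data_shift s.+1)%N.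
  move=> si; have : (4 ^ i <= 4 ^ s)%N by rewrite leq_exp2l.
  by rewrite /= -r1; lia.
have := diag_return_ge R t lev_fin far.
set p : R := prob; set K := #|_|.
set S := (\sum_(s < i) level_dim (level_of f) s)%N.
set a : R := 4 ^+ i.
have a_gt0 : 0 < a by rewrite exprn_gt0 // ltr0n.
have g_gt0 : 0 < g := gamma_gt0 t_gt0.
have a2 : 16 ^+ i = a ^+ 2 by rewrite /a exprAC; congr (_ ^+ i); rewrite -natrX.
have ag c : 0 <= c -> c ^+ 2 <= size2 t -> a * c <= g.
  move=> c0 ct; rewrite -(ler_sqr (mulr_ge0 (ltW a_gt0) c0) (ltW g_gt0)).
  rewrite (gamma_sqr t_gt0) exprMn.
  by rewrite ler_pM ?sqr_ge0 // -a2.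
have aS : a * S%:R <= 6 * g.
  have [i0|i_gt0] := posnP i.
    by rewrite /S i0 big_ord0 mulr0 mulr_ge0 // ltW.
  have iE : i = i.-1.+1 by rewrite prednK.
  have i1 : (i.-1 < i)%N by rewrite -iE.
  case fj : (f i.-1) (lev_fin _ i1) => [e|]; last by rewrite level_of_None fj.
  move=> _; have [je _] := f_Some fj; rewrite iE in ti.
  have := ag (2 ^+ e) (exprn_ge0 _ (ler0n _ _)).
  have -> : (2 ^+ e) ^+ 2 = 4 ^+ e :> R by rewrite exprAC; congr (_ ^+ e); rewrite -natrX.
  move=> /(_ (reached_before ti je)).
  have : S%:R <= 6 * 2 ^+ e :> R.
    by rewrite -natrX -natrM ler_nat /S iE (sum_level_of f_homo).
  by move=> /(ler_wpM2l (ltW a_gt0)); lra.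
(* The [(2 * r).+1] positions are at most [17 ^ (2 * r).+1], which brings all factors to base 17. *)
have KN : (K <= 17 ^ (6 * 4 ^ i + 8 * 4 ^ i * S))%N.
  rewrite /K card_key_type -/S -!expnM -mulnA -expnD -r1.
  have h : ((2 * r).+1 <= 17 ^ (2 * r).+1)%N by exact/ltnW/ltn_expl.
  apply: leq_trans (leq_mul h (leqnn _)) _; rewrite -expnD leq_exp2l //.
  by move: (r * S)%N (erefl (r * S)%N) => rS; nia.
(* Here [17 <= expR 16], and the exponent is at most [6 * g + 8 * (6 * g) = 54 * g]. *)
have K17 : K%:R <= expR (16 * (54 * g)) :> R.
  apply: le_trans (_ : (17 ^ (6 * 4 ^ i + 8 * 4 ^ i * S))%:R <= _); first by rewrite ler_nat.
  rewrite natrX; apply: le_trans (_ : expR 16 ^+ (6 * 4 ^ i + 8 * 4 ^ i * S) <= _).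
    rewrite lerXn2r ?nnegrE ?expR_ge0 //.
    by apply: le_trans (expR_ge1Dx _); lra.
  rewrite -expRM_natl ler_expR mulrC ler_pM2l ?ltr0n // natrD !natrM natrX -/a.
  by have := ag 1 ler01; rewrite expr1n => /(_ size2_ge1); lra.
have rate_exp : expR (- (64 * g)) <= survival_rate R r ^+ (2 * t).
  apply: le_trans (_ : expR (- (2 * r.+1%:R ^- 2)) ^+ (2 * t) <= _); last first.
    rewrite lerXn2r ?nnegrE ?expR_ge0 ?survival_rate_ge //.
    exact: le_trans (expR_ge0 _) (survival_rate_ge _ _).
  rewrite -expRM_natl ler_expR r1 mulrN lerN2 natrX -/a natrM.
  rewrite mulrA ler_pdivrMr ?exprn_gt0 //.
  have : t%:R <= g * (16 * a ^+ 2).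
    rewrite (gamma_radius2 t_gt0) mulrAC ler_pdivlMr ?(lt_le_trans ltr01) //.
    by rewrite ler_wpM2l // -a2 -exprS ltW.
  lra.
move=> /(le_trans rate_exp) Kp.
have p_ge0 : 0 <= p by apply: walk_prob_ge0; exact: step_weight_ge0.
(* The two exponents add up to [16 * 54 + 64 = 928]. *)
have {Kp}p_ge : expR (- (1000 * g)) <= p.
  have e_gt0 := expR_gt0 (16 * (54 * g)).
  rewrite -(ler_pM2l e_gt0); apply: le_trans (ler_wpM2r p_ge0 K17).
  by apply: le_trans Kp; rewrite -expRD ler_expR; lra.
have p_gt0 : 0 < p by apply: lt_le_trans (expR_gt0 _) p_ge.
split=> //; rewrite lerNl -(expRK (- (1000 * g))).
by rewrite ler_ln ?posrE ?expR_gt0.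
Qed.

End Bounds.
End Growth.

Theorem theorem4p8 (R : realType) :
  exists c C : R, [/\ 0 < c, 0 < C &
    forall gamma : R -> R,
      (forall x : R, 1 <= x -> 1 <= gamma x) ->
      gamma 1 = 1 ->
      (forall x y : R, 1 <= x -> x <= y ->
         gamma x / x `^ (1 / 3) <= gamma y / y `^ (1 / 3)) ->
      (forall x y : R, 1 <= x -> x <= y -> x / gamma x <= y / gamma y) ->
      exists D : diagonal_data, forall t : nat, (1 <= t)%N ->
        c * gamma t%:R
          <= - ln (convolution_power (switch_or_walk R D) (2 * t) 1%g)
          <= C * gamma t%:R].
Proof.
exists (1 / 720), 1000; split=> [||gamma gamma_ge1 gamma1 gamma_cube gamma_lin]; [lra|lra|].
have [f [f_Some f_None f_homo]] := level_choice gamma1.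
exists (diag_data (level_of f)) => t t_gt0.
have [p_gt0 p_ge] := prob_ge gamma_ge1 gamma1 gamma_cube gamma_lin f_Some f_None f_homo t_gt0.
rewrite convolution_powerE p_ge andbT.
have := prob_le gamma_ge1 gamma1 gamma_cube gamma_lin f_Some t_gt0 p_gt0.
by rewrite mulrC mul1r.
Qed.
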